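(* Let $n\ge 1$. Define $$\mathcal{K}_{\rm SDP} := \left\{(y_0,y,Y) : Y \text{ submodular},\ \exists\, Z\in\mathbb{R}^{n\times n}\text{ s.t. } Z\ge 0,\ \begin{pmatrix} y_0 & (y^T-e^TZ)/2\\ (y-Z^Te)/2 & Y+(Z+Z^T)/2\end{pmatrix}\succeq 0\right\}$$ and $$\mathcal{M}_{\rm SDP} := \left\{(\lambda_0,\lambda,\Lambda) : \exists\, W\in\mathbb{S}^n \text{ s.t. } \Lambda\le W\le \lambda e^T,\ \mathrm{diag}(\Lambda)=\mathrm{diag}(W),\ \begin{pmatrix}\lambda_0 & \lambda^T\\ \lambda & W\end{pmatrix}\succeq 0\right\},$$ both subsets of $\mathbb{R}\times\mathbb{R}^n\times\mathbb{S}^n$. Then $\mathcal{K}_{\rm SDP}\subseteq \mathcal{K}_0$ and $\mathcal{M}_0\subseteq\mathcal{M}_{\rm SDP}$, with equality in both when $n\le 3$.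
   Context: $\mathbb{S}^n$ is the space of symmetric real $n\times n$ matrices; $e$ is the all-ones vector; matrix inequalities $\le,\ge$ are entrywise; $\succeq 0$ means positive semidefinite; $\mathrm{diag}(A)$ is the vector of diagonal entries of $A$. A symmetric matrix $Y$ is called submodular if $Y_{ij}\le 0$ for all $i\ne j$. Let $\mathcal{M}([0,1]^n)$ denote the set of all nonnegative finite Borel measures on $[0,1]^n$. The cones $\mathcal{M}_0,\mathcal{K}_0\subseteq \mathbb{R}\times\mathbb{R}^n\times\mathbb{S}^n$ are $$\mathcal{M}_0 := \left\{(\lambda_0,\lambda,\Lambda) : \exists\, m\in\mathcal{M}([0,1]^n)\text{ s.t. } \lambda_0=\int dm(\xi),\ \lambda=\int\xi\,dm(\xi),\ \Lambda\le\int\xi\xi^T dm(\xi),\ \mathrm{diag}(\Lambda)=\int\mathrm{diag}(\xi\xi^T)\,dm(\xi)\right\},$$ $$\mathcal{K}_0 := \left\{(y_0,y,Y) : y_0+y^T\xi+\xi^TY\xi\ge 0\ \ \forall\,\xi\in[0,1]^n,\ Y\text{ submodular}\right\}.$$ *)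

(* Defs.v *)
From HB Require Import structures.
From mathcomp Require Import all_boot all_order all_algebra.
From mathcomp Require Import all_classical all_reals all_analysis.

Set Implicit Arguments.
Unset Strict Implicit.
Unset Printing Implicit Defensive.

Import Order.TTheory GRing.Theory Num.Theory.
Import numFieldNormedType.Exports.

Local Open Scope classical_set_scope.
Local Open Scope ring_scope.

Definition lemx {R : realType} {p q : nat} (A B : 'M[R]_(p, q)) : Prop :=
  forall i j, A i j <= B i j.

Notation "A <=m B" := (lemx A B) (at level 70, no associativity).

Definition diagv {R : realType} {n : nat} (A : 'M[R]_n) : 'cV[R]_n :=
  \col_i A i i.

Definition ones {R : realType} {n : nat} : 'cV[R]_n := const_mx 1.

Definition psdmx {R : realType} {p : nat} (A : 'M[R]_p) : Prop :=
  A \is symmetricmx /\ forall x : 'cV[R]_p, 0 <= (x^T *m A *m x) 0 0.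

Definition submodular {R : realType} {n : nat} (Y : 'M[R]_n) : Prop :=
  Y \is symmetricmx /\ forall i j, i != j -> Y i j <= 0.

Definition bordermx {R : realType} {n : nat}
    (a : R) (u : 'rV[R]_n) (v : 'cV[R]_n) (A : 'M[R]_n) : 'M[R]_(1 + n) :=
  block_mx a%:M u v A.

Definition cube (R : realType) (n : nat) : set 'cV[R]_n :=
  [set x | forall i, 0 <= x i 0 <= 1].
Arguments cube R n : clear implicits.

(* [0,1]^n as a space of its own, with the topology inherited from R^n; the
   base point is only there because measurable types have to be pointed. *)
Definition cube_space (R : realType) (n : nat) : Type := set_type (cube R n).

Lemma cube0 (R : realType) (n : nat) : (0 : 'cV[R]_n) \in cube R n.
Proof. by apply/mem_set => i; rewrite mxE lexx ler01. Qed.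

HB.instance Definition _ (R : realType) (n : nat) :=
  Topological.copy (cube_space R n) (set_type (cube R n)).
HB.instance Definition _ (R : realType) (n : nat) :=
  isPointed.Build (cube_space R n) (exist _ 0 (cube0 R n)).

Definition cube_val {R : realType} {n : nat} (x : cube_space R n) : 'cV[R]_n :=
  val x.

Definition borel_cube (R : realType) (n : nat) :=
  g_sigma_algebraType (@open (cube_space R n)).

(* Entrywise integral of a matrix-valued function.  It is only applied to
   bounded Borel functions and finite measures, so that each entry is
   integrable and Rintegral does not take its default value. *)
Definition mx_integral {R : realType} {n p q : nat}
    (m : {finite_measure set (borel_cube R n) -> \bar R})
    (f : borel_cube R n -> 'M[R]_(p, q)) : 'M[R]_(p, q) :=
  \matrix_(i, j) \int[m]_x f x i j.

(* The cones live in R * R^n * S^n; membership in S^n is a conjunct of each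
   definition (contained in [submodular] for the K-cones). *)
Definition M0 (R : realType) (n : nat) : set (R * 'cV[R]_n * 'M[R]_n) :=
  [set t | let: (l0, l, L) := t in
    L \is symmetricmx /\
    exists m : {finite_measure set (borel_cube R n) -> \bar R},
      [/\ l0 = \int[m]_x 1,
          l = mx_integral m (fun x => cube_val x),
          L <=m mx_integral m (fun x => cube_val x *m (cube_val x)^T) &
          diagv L =
            mx_integral m (fun x => diagv (cube_val x *m (cube_val x)^T))]].

Definition K0 (R : realType) (n : nat) : set (R * 'cV[R]_n * 'M[R]_n) :=
  [set t | let: (y0, y, Y) := t in
    (forall x : 'cV[R]_n, cube R n x ->
       0 <= y0 + (y^T *m x) 0 0 + (x^T *m Y *m x) 0 0) /\
    submodular Y].

Definition K_SDP (R : realType) (n : nat) : set (R * 'cV[R]_n * 'M[R]_n) :=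
  [set t | let: (y0, y, Y) := t in
    submodular Y /\
    exists Z : 'M[R]_n,
      0 <=m Z /\
      psdmx (bordermx y0 (2^-1 *: (y^T - ones^T *m Z))
               (2^-1 *: (y - Z^T *m ones)) (Y + 2^-1 *: (Z + Z^T)))].

Definition M_SDP (R : realType) (n : nat) : set (R * 'cV[R]_n * 'M[R]_n) :=
  [set t | let: (l0, l, L) := t in
    L \is symmetricmx /\
    exists W : 'M[R]_n,
      [/\ W \is symmetricmx,
          L <=m W,
          W <=m l *m ones^T,
          diagv L = diagv W &
          psdmx (bordermx l0 l^T l W)]].

Arguments M0 R n : clear implicits.
Arguments K0 R n : clear implicits.
Arguments K_SDP R n : clear implicits.
Arguments M_SDP R n : clear implicits.

(* Main.v *)
(* For M_SDP = M0 one has to find, for m0 = 1, a random vector of [0,1]^n with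
   prescribed means m_i and second moments q_i, and with mixed moments at least
   c_ij, knowing that the moment matrix is positive semidefinite and that
   c_ij <= min (m_i, m_j).  If all correlations can be raised to 1 without violating
   these bounds, then a vector with two values, all of whose coordinates are
   comonotone, does it: each coordinate restricts the odds of the two values to an
   interval, and the bounds say exactly that these intervals meet pairwise.
   Otherwise, while the correlations are raised some bound becomes tight, say
   c_12 = m_2, which forces x_1 = 1 wherever x_2 > 0.  For n = 3, the third
   coordinate can be pushed towards an increasing affine function of x_1 and x_2; then
   either three atoms on a monotone chain suffice, or a second bound becomes tight,
   and splitting off one atom leaves a problem in dimension two.  The cases n < 3
   follow by padding with zero coordinates.
   For K_SDP = K0, a point of K0 without certificate is separated from the closed
   cone of certified forms by some (l0, l, W), which satisfies the constraints of
   M_SDP; a measure dominating it, as constructed above, gives a nonnegative integral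
   to the form, whereas the separation says that it is negative. *)

From HB Require Import structures.
Require Import Defs.
From mathcomp Require Import all_boot all_order all_algebra.
From mathcomp Require Import all_classical all_reals all_analysis.
From mathcomp Require Import measurable_realfun ring lra.

Set Implicit Arguments.
Unset Strict Implicit.
Unset Printing Implicit Defensive.

Import Order.TTheory GRing.Theory Num.Theory.
Import numFieldNormedType.Exports.

Local Open Scope classical_set_scope.
Local Open Scope ring_scope.

(** * Discrete moment problems on the square and the cube *)

(** For a > 0 the value at (k, -a) is a (a b - k^2). For a = 0 the form is affine in x, which forces
    k = 0. *)
Lemma discriminant_le (R : realFieldType) (a k b : R) :
  (forall x y, 0 <= a * x ^+ 2 + 2 * k * x * y + b * y ^+ 2) -> k ^+ 2 <= a * b.
Proof.
move=> h; have a_ge0 : 0 <= a by have := h 1 0; lra.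
have [a0|a_neq0] := eqVneq a 0.
  have [->|k0] := eqVneq k 0; first by rewrite a0; lra.
  have := h (- (b + 1) / (2 * k)) 1.
  have -> : a * (- (b + 1) / (2 * k)) ^+ 2 + 2 * k * (- (b + 1) / (2 * k)) * 1
            + b * 1 ^+ 2 = -1 by rewrite a0; field.
  lra.
have a_gt0 : 0 < a by rewrite lt_def a_neq0.
have := h k (- a).
have -> : a * k ^+ 2 + 2 * k * k * - a + b * (- a) ^+ 2 = a * (a * b - k ^+ 2)
  by ring.
by rewrite pmulr_rge0 // subr_ge0.
Qed.

(** The least ratio a i / (a i - b i) over the indices with b i < 0 is the first time at which a
    coordinate vanishes on the way from a to b. It serves to raise mixed moments until a bound
    becomes tight. *)
Lemma segment_exit (R : realFieldType) (I : finType) (a b : I -> R) :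
  (forall i, 0 <= a i) ->
  (forall i, 0 <= b i) \/
  exists t, [/\ 0 <= t <= 1, forall i, 0 <= a i + t * (b i - a i)
               & exists i, a i + t * (b i - a i) = 0].
Proof.
move=> a_ge0.
have [/forallP|/forallPn [i0]] := boolP [forall i, 0 <= b i]; first by left.
rewrite -ltNge => bi0; right.
case: (arg_minP (fun i => a i / (a i - b i)) (bi0 : (fun i => b i < 0) i0)).
move=> i bi_lt0 i_min; exists (a i / (a i - b i)).
have ab_gt0 j : b j < 0 -> 0 < a j - b j by have := a_ge0 j; lra.
split.
- rewrite divr_ge0 ?a_ge0 ?(ltW (ab_gt0 _ bi_lt0)) //=.
  by rewrite ler_pdivrMr ?ab_gt0 //; lra.
- move=> j; have t_ge0 : 0 <= a i / (a i - b i).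
    by rewrite divr_ge0 ?a_ge0 ?(ltW (ab_gt0 _ bi_lt0)).
  have t_le1 : a i / (a i - b i) <= 1 by rewrite ler_pdivrMr ?ab_gt0 //; lra.
  have [bj_ge0|bj_lt0] := leP 0 (b j).
    have := a_ge0 j; move: (a i / _) t_ge0 t_le1 => t; nra.
  have := i_min _ bj_lt0; rewrite [X in _ <= X -> _]/=.
  by rewrite ler_pdivlMr ?ab_gt0 //; lra.
- by exists i; have := ab_gt0 _ bi_lt0; move=> h; field; apply: lt0r_neq0.
Qed.

(** For s i > 0 the conclusion confines t to the interval from s i / m i to (1 - m i) / s i, and the
    hypothesis says that these intervals meet pairwise. As in Helly's theorem on the line, the
    largest left endpoint lies in all of them. *)
Lemma common_slope (R : realFieldType) (I : finType) (m s : I -> R) :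
  (forall i, 0 <= m i) -> (forall i, 0 <= s i) ->
  (forall i j, s i * s j <= m i * (1 - m j)) ->
  exists2 t, 0 < t & forall i, s i * t <= 1 - m i /\ s i <= m i * t.
Proof.
move=> m_ge0 s_ge0 h.
have m_le1 i : m i <= 1.
  have := h i i; have := m_ge0 i; have := s_ge0 i; nra.
have [/forallP s0|/forallPn [i0 si0]] := boolP [forall i, s i == 0].
  exists 1 => // i; rewrite (eqP (s0 i)); have := m_le1 i; have := m_ge0 i; lra.
have s_gt0 : 0 < s i0 by rewrite lt_def si0 s_ge0.
have m_gt0 j : 0 < s j -> 0 < m j.
  move=> sj; rewrite lt_def m_ge0 andbT; apply/eqP => mj0.
  by have := h j j; rewrite mj0; nra.
case: (arg_maxP (fun i => s i / m i) (s_gt0 : (fun i => 0 < s i) i0)).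
move=> i si_gt0 i_max.
exists (s i / m i); first by rewrite divr_gt0 ?m_gt0.
move=> j; split.
  rewrite mulrA ler_pdivrMr ?m_gt0 //.
  by have := h i j; lra.
have [sj_gt0|sj_le0] := ltP 0 (s j).
  by rewrite mulrC -ler_pdivrMr ?m_gt0 //; exact: i_max.
by apply: (le_trans sj_le0); rewrite mulr_ge0 ?divr_ge0.
Qed.

(** * Moment data in scalar form and operations on finitely supported measures *)

Definition psd3 (R : rcfType) (m0 m1 m2 q1 q2 c12 : R) : Prop :=
  forall x0 x1 x2, 0 <= m0 * x0 ^+ 2 + q1 * x1 ^+ 2 + q2 * x2 ^+ 2
    + 2 * (m1 * x0 * x1 + m2 * x0 * x2 + c12 * x1 * x2).

Definition psd4 (R : rcfType) (m0 m1 m2 m3 q1 q2 q3 c12 c13 c23 : R) : Prop :=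
  forall x0 x1 x2 x3,
    0 <= m0 * x0 ^+ 2 + q1 * x1 ^+ 2 + q2 * x2 ^+ 2 + q3 * x3 ^+ 2
    + 2 * (m1 * x0 * x1 + m2 * x0 * x2 + m3 * x0 * x3
           + c12 * x1 * x2 + c13 * x1 * x3 + c23 * x2 * x3).

(** The constraints of [M_SDP] on (l0, l, W) for n = 2: [psd3] is the form of the moment matrix, and
    by symmetry of W the bound W <= l e^T limits the mixed entry twice. *)
Definition feasible2 (R : rcfType) (m0 m1 m2 q1 q2 c12 : R) : Prop :=
  [/\ psd3 m0 m1 m2 q1 q2 c12, q1 <= m1, q2 <= m2, c12 <= m1 & c12 <= m2].

Definition feasible3 (R : rcfType) (m0 m1 m2 m3 q1 q2 q3 c12 c13 c23 : R) :
  Prop :=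
  [/\ psd4 m0 m1 m2 m3 q1 q2 q3 c12 c13 c23, [/\ q1 <= m1, q2 <= m2 & q3 <= m3],
      c12 <= m1 /\ c12 <= m2, c13 <= m1 /\ c13 <= m3 & c23 <= m2 /\ c23 <= m3].

(* [moments2 m0 m1 m2 q1 q2 c12]: some finitely supported measure on [0,1]^2
   has mass m0, means m1, m2, second moments q1, q2 and a mixed moment that is
   at least c12.  Likewise for [moments3]. *)
Inductive moments2 (R : rcfType) : R -> R -> R -> R -> R -> R -> Prop :=
| moments2_zero c12 : c12 <= 0 -> moments2 0 0 0 0 0 c12
| moments2_atom m0 m1 m2 q1 q2 c12 w x y m0' m1' m2' q1' q2' c12' :
    moments2 m0' m1' m2' q1' q2' c12' ->
    0 <= w -> 0 <= x <= 1 -> 0 <= y <= 1 ->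
    m0 = m0' + w -> m1 = m1' + w * x -> m2 = m2' + w * y ->
    q1 = q1' + w * x ^+ 2 -> q2 = q2' + w * y ^+ 2 ->
    c12 <= c12' + w * x * y ->
    moments2 m0 m1 m2 q1 q2 c12.

Inductive moments3 (R : rcfType) :
  R -> R -> R -> R -> R -> R -> R -> R -> R -> R -> Prop :=
| moments3_zero c12 c13 c23 : c12 <= 0 -> c13 <= 0 -> c23 <= 0 ->
    moments3 0 0 0 0 0 0 0 c12 c13 c23
| moments3_atom m0 m1 m2 m3 q1 q2 q3 c12 c13 c23 w x y z
    m0' m1' m2' m3' q1' q2' q3' c12' c13' c23' :
    moments3 m0' m1' m2' m3' q1' q2' q3' c12' c13' c23' ->
    0 <= w -> 0 <= x <= 1 -> 0 <= y <= 1 -> 0 <= z <= 1 ->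
    m0 = m0' + w -> m1 = m1' + w * x -> m2 = m2' + w * y -> m3 = m3' + w * z ->
    q1 = q1' + w * x ^+ 2 -> q2 = q2' + w * y ^+ 2 -> q3 = q3' + w * z ^+ 2 ->
    c12 <= c12' + w * x * y -> c13 <= c13' + w * x * z ->
    c23 <= c23' + w * y * z ->
    moments3 m0 m1 m2 m3 q1 q2 q3 c12 c13 c23.

Lemma moments2_swap (R : rcfType) (m0 m1 m2 q1 q2 c12 : R) :
  moments2 m0 m1 m2 q1 q2 c12 -> moments2 m0 m2 m1 q2 q1 c12.
Proof.
elim=> {m0 m1 m2 q1 q2 c12} [c12 h|m0 m1 m2 q1 q2 c12 w x y m0' m1' m2' q1' q2'
  c12' _ IH w0 x01 y01 *]; first exact: moments2_zero.
by apply: (moments2_atom IH w0 y01 x01) => //; lra.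
Qed.

Lemma moments3_swap12 (R : rcfType) (m0 m1 m2 m3 q1 q2 q3 c12 c13 c23 : R) :
  moments3 m0 m1 m2 m3 q1 q2 q3 c12 c13 c23 ->
  moments3 m0 m2 m1 m3 q2 q1 q3 c12 c23 c13.
Proof.
elim=> {m0 m1 m2 m3 q1 q2 q3 c12 c13 c23} [*|m0 m1 m2 m3 q1 q2 q3 c12 c13 c23
  w x y z m0' m1' m2' m3' q1' q2' q3' c12' c13' c23' _ IH w0 x01 y01 z01 *].
  exact: moments3_zero.
by apply: (moments3_atom IH w0 y01 x01 z01) => //; lra.
Qed.

Lemma moments3_swap23 (R : rcfType) (m0 m1 m2 m3 q1 q2 q3 c12 c13 c23 : R) :
  moments3 m0 m1 m2 m3 q1 q2 q3 c12 c13 c23 ->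
  moments3 m0 m1 m3 m2 q1 q3 q2 c13 c12 c23.
Proof.
elim=> {m0 m1 m2 m3 q1 q2 q3 c12 c13 c23} [*|m0 m1 m2 m3 q1 q2 q3 c12 c13 c23
  w x y z m0' m1' m2' m3' q1' q2' q3' c12' c13' c23' _ IH w0 x01 y01 z01 *].
  exact: moments3_zero.
by apply: (moments3_atom IH w0 x01 z01 y01) => //; lra.
Qed.

Lemma moments2_scale (R : rcfType) (k m0 m1 m2 q1 q2 c12 : R) :
  0 <= k -> moments2 m0 m1 m2 q1 q2 c12 ->
  moments2 (k * m0) (k * m1) (k * m2) (k * q1) (k * q2) (k * c12).
Proof.
move=> k0; elim=> {m0 m1 m2 q1 q2 c12} [c12 h|m0 m1 m2 q1 q2 c12 w x y m0' m1'
  m2' q1' q2' c12' _ IH w0 x01 y01 -> -> -> -> -> h].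
  by rewrite mulr0; apply: moments2_zero; nra.
apply: (moments2_atom IH (mulr_ge0 k0 w0) x01 y01); try ring.
by have := ler_wpM2l k0 h; lra.
Qed.

Lemma moments3_scale (R : rcfType) (k m0 m1 m2 m3 q1 q2 q3 c12 c13 c23 : R) :
  0 <= k -> moments3 m0 m1 m2 m3 q1 q2 q3 c12 c13 c23 ->
  moments3 (k * m0) (k * m1) (k * m2) (k * m3) (k * q1) (k * q2) (k * q3)
    (k * c12) (k * c13) (k * c23).
Proof.
move=> k0; elim=> {m0 m1 m2 m3 q1 q2 q3 c12 c13 c23} [c12 c13 c23 *|
  m0 m1 m2 m3 q1 q2 q3 c12 c13 c23 w x y z m0' m1' m2' m3' q1' q2' q3' c12'
  c13' c23' _ IH w0 x01 y01 z01 -> -> -> -> -> -> -> h12 h13 h23].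
  by rewrite mulr0; apply: moments3_zero; nra.
apply: (moments3_atom IH (mulr_ge0 k0 w0) x01 y01 z01); try ring.
- by have := ler_wpM2l k0 h12; lra.
- by have := ler_wpM2l k0 h13; lra.
- by have := ler_wpM2l k0 h23; lra.
Qed.

(** An atom of weight 0 absorbs the slack. *)
Lemma moments3_le (R : rcfType)
    (m0 m1 m2 m3 q1 q2 q3 c12 c13 c23 d12 d13 d23 : R) :
  d12 <= c12 -> d13 <= c13 -> d23 <= c23 ->
  moments3 m0 m1 m2 m3 q1 q2 q3 c12 c13 c23 ->
  moments3 m0 m1 m2 m3 q1 q2 q3 d12 d13 d23.
Proof.
move=> h12 h13 h23 h; apply: (moments3_atom h (lexx 0) (x := 0) (y := 0) (z := 0));
  rewrite ?lexx ?ler01 //; lra.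
Qed.

Lemma moments2_le (R : rcfType) (m0 m1 m2 q1 q2 c12 d12 : R) :
  d12 <= c12 -> moments2 m0 m1 m2 q1 q2 c12 -> moments2 m0 m1 m2 q1 q2 d12.
Proof.
move=> h12 h; apply: (moments2_atom h (lexx 0) (x := 0) (y := 0));
  rewrite ?lexx ?ler01 //; lra.
Qed.

(** All atoms receive the first coordinate x; with x = 0 or x = 1 the planar measure is placed on a
    face of the cube. *)
Lemma moments2_extend (R : rcfType) (x m0 m1 m2 q1 q2 c12 : R) :
  0 <= x <= 1 -> moments2 m0 m1 m2 q1 q2 c12 ->
  moments3 m0 (x * m0) m1 m2 (x ^+ 2 * m0) q1 q2 (x * m1) (x * m2) c12.
Proof.
move=> x01; elim=> {m0 m1 m2 q1 q2 c12} [c12 h|m0 m1 m2 q1 q2 c12 w y z m0' m1'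
  m2' q1' q2' c12' _ IH w0 y01 z01 -> -> -> -> -> h].
  by rewrite !mulr0; apply: moments3_zero.
by apply: (moments3_atom IH w0 x01 y01 z01) => //; lra.
Qed.

(** * The planar moment problem *)

Lemma psd3_m0 (R : rcfType) (m0 m1 m2 q1 q2 c12 : R) :
  psd3 m0 m1 m2 q1 q2 c12 -> 0 <= m0.
Proof. by move=> h; have := h 1 0 0; lra. Qed.

Lemma feasible2_bounds (R : rcfType) (m1 m2 q1 q2 c12 : R) :
  feasible2 1 m1 m2 q1 q2 c12 ->
  [/\ 0 <= m1 <= 1, 0 <= m2 <= 1, 0 <= q1 - m1 ^+ 2 & 0 <= q2 - m2 ^+ 2].
Proof.
case=> h q1m q2m _ _.
have := h 0 1 0; have := h 0 0 1.
have := h (- m1) 1 0; have := h (- m2) 0 1 => h1 h2 h3 h4.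
have v1 : 0 <= q1 - m1 ^+ 2 by lra.
have v2 : 0 <= q2 - m2 ^+ 2 by lra.
split=> //; apply/andP; split; nra.
Qed.

(** Minimizing over the constant term, that is, taking it to be - (m1 x + m2 y), leaves the
    quadratic form of the covariance matrix. *)
Lemma psd3_cov (R : rcfType) (m1 m2 q1 q2 c12 : R) :
  psd3 1 m1 m2 q1 q2 c12 ->
  (c12 - m1 * m2) ^+ 2 <= (q1 - m1 ^+ 2) * (q2 - m2 ^+ 2).
Proof.
move=> h; apply: discriminant_le => x y.
by have := h (- (m1 * x + m2 * y)) x y; lra.
Qed.

(** The right-hand side is the mixed moment at correlation 1, towards which [c12] is raised. *)
Lemma psd3_cov_sqrt (R : rcfType) (m1 m2 q1 q2 c12 : R) :
  psd3 1 m1 m2 q1 q2 c12 -> 0 <= q1 - m1 ^+ 2 ->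
  c12 <= m1 * m2 + Num.sqrt (q1 - m1 ^+ 2) * Num.sqrt (q2 - m2 ^+ 2).
Proof.
move=> h v1; have /psd3_cov := h.
move=> /ler_wsqrtr; rewrite sqrtr_sqr sqrtrM // => h'.
have := ler_norm (c12 - m1 * m2); lra.
Qed.

Lemma two_point_range (R : rcfType) (m s t : R) : 0 < t ->
  0 <= s -> s * t <= 1 - m -> s <= m * t ->
  0 <= m + s * t <= 1 /\ 0 <= m - s / t <= 1.
Proof.
move=> t0 s0 h k; have q0 : 0 <= s / t by rewrite divr_ge0 // ltW.
have q1 : s / t <= m by rewrite ler_pdivrMr.
by split; apply/andP; split; nra.
Qed.

(** The values m + s t, with probability 1 / (1 + t^2), and m - s / t, with the remaining
    probability, have mean m and variance s^2. Both coordinates are large together, hence the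
    covariance s1 s2. *)
Lemma two_point2 (R : rcfType) (m1 m2 s1 s2 t : R) : 0 < t ->
  0 <= s1 -> 0 <= s2 -> s1 * t <= 1 - m1 -> s1 <= m1 * t ->
  s2 * t <= 1 - m2 -> s2 <= m2 * t ->
  moments2 1 m1 m2 (m1 ^+ 2 + s1 ^+ 2) (m2 ^+ 2 + s2 ^+ 2) (m1 * m2 + s1 * s2).
Proof.
move=> t0 s10 s20 h1 k1 h2 k2.
have t_neq0 : t != 0 by rewrite gt_eqF.
have d_gt0 : 0 < 1 + t ^+ 2 by rewrite ltr_pwDl // sqr_ge0.
have d_neq0 : 1 + t ^+ 2 != 0 by rewrite gt_eqF.
have [hi1 lo1] := two_point_range t0 s10 h1 k1.
have [hi2 lo2] := two_point_range t0 s20 h2 k2.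
have wh : 0 <= (1 + t ^+ 2)^-1 by rewrite invr_ge0 ltW.
have wl : 0 <= t ^+ 2 * (1 + t ^+ 2)^-1 by rewrite mulr_ge0 ?sqr_ge0.
apply: (moments2_atom _ wh hi1 hi2).
- by apply: (moments2_atom (moments2_zero (lexx 0)) wl lo1 lo2);
    (reflexivity || exact: lexx).
all: try (rewrite le_eqVlt; apply/orP; left; apply/eqP).
all: by field; rewrite ?d_neq0 ?t_neq0.
Qed.

Lemma two_point3 (R : rcfType) (m1 m2 m3 s1 s2 s3 t : R) : 0 < t ->
  0 <= s1 -> 0 <= s2 -> 0 <= s3 -> s1 * t <= 1 - m1 -> s1 <= m1 * t ->
  s2 * t <= 1 - m2 -> s2 <= m2 * t -> s3 * t <= 1 - m3 -> s3 <= m3 * t ->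
  moments3 1 m1 m2 m3 (m1 ^+ 2 + s1 ^+ 2) (m2 ^+ 2 + s2 ^+ 2)
    (m3 ^+ 2 + s3 ^+ 2) (m1 * m2 + s1 * s2) (m1 * m3 + s1 * s3)
    (m2 * m3 + s2 * s3).
Proof.
move=> t0 s10 s20 s30 h1 k1 h2 k2 h3 k3.
have t_neq0 : t != 0 by rewrite gt_eqF.
have d_gt0 : 0 < 1 + t ^+ 2 by rewrite ltr_pwDl // sqr_ge0.
have d_neq0 : 1 + t ^+ 2 != 0 by rewrite gt_eqF.
have [hi1 lo1] := two_point_range t0 s10 h1 k1.
have [hi2 lo2] := two_point_range t0 s20 h2 k2.
have [hi3 lo3] := two_point_range t0 s30 h3 k3.
have wh : 0 <= (1 + t ^+ 2)^-1 by rewrite invr_ge0 ltW.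
have wl : 0 <= t ^+ 2 * (1 + t ^+ 2)^-1 by rewrite mulr_ge0 ?sqr_ge0.
apply: (moments3_atom _ wh hi1 hi2 hi3).
- by apply: (moments3_atom (moments3_zero (lexx 0) (lexx 0) (lexx 0)) wl lo1 lo2
    lo3); (reflexivity || exact: lexx).
all: try (rewrite le_eqVlt; apply/orP; left; apply/eqP).
all: by field; rewrite ?d_neq0 ?t_neq0.
Qed.

(* An atom of weight [c * g] at [e] has first moment g and second moment gg; the
   0 / 0 = 0 convention covers g = gg = 0. *)
Lemma one_atom (R : rcfType) (g gg : R) : 0 <= gg -> gg <= g -> g ^+ 2 <= gg ->
  exists c e, [/\ 0 <= c, 0 <= e <= 1, c * gg = g, c * g * e = g
                & c * g * e ^+ 2 = gg].
Proof.
move=> gg_ge0 gg_le g2_le; exists (g / gg), (gg / g).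
have [gg0|gg_neq0] := eqVneq gg 0.
  have -> : g = 0.
    by apply/eqP; rewrite -sqrf_eq0 eq_le sqr_ge0 andbT -gg0.
  by rewrite gg0 !mul0r lexx ler01; split=> //; ring.
have gg_gt0 : 0 < gg by rewrite lt_def gg_neq0.
have g_gt0 : 0 < g by lra.
have g_neq0 : g != 0 by rewrite gt_eqF.
split.
- by rewrite divr_ge0 // ltW.
- by rewrite divr_ge0 ?(ltW g_gt0) //= ler_pdivrMr // mul1r.
all: by field; rewrite ?g_neq0.
Qed.

(* If the mixed moment is maximal, m2, then y > 0 forces x = 1, and the measure
   can be taken on the chain A = (1 - e, 0), B = (1, 0), C = (1, b). *)
Lemma chain_weights (R : rcfType) (m1 m2 q1 q2 : R) :
  feasible2 1 m1 m2 q1 q2 m2 ->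
  exists wA wB wC e b,
    [/\ [/\ 0 <= wA, 0 <= wB & 0 <= wC], wA + wB + wC = 1,
        0 <= e <= 1 /\ 0 <= b <= 1,
        wA * e = 1 - m1 /\ wA * e ^+ 2 = 1 - 2 * m1 + q1
      & wC * b = m2 /\ wC * b ^+ 2 = q2].
Proof.
move=> [h q1m q2m m2m _].
have [c [e [c0 e01 cgg ce cee]]] :
  exists c e, [/\ 0 <= c, 0 <= e <= 1, c * (1 - 2 * m1 + q1) = 1 - m1,
    c * (1 - m1) * e = 1 - m1 & c * (1 - m1) * e ^+ 2 = 1 - 2 * m1 + q1].
  apply: one_atom; have := h (- m1) 1 0; have := h (- 1) 1 0; lra.
have [d [b [d0 b01 dq db dbb]]] :
  exists c e, [/\ 0 <= c, 0 <= e <= 1, c * q2 = m2,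
    c * m2 * e = m2 & c * m2 * e ^+ 2 = q2].
  apply: one_atom; have := h (- m2) 0 1; have := h 0 0 1; lra.
exists (c * (1 - m1)), (1 - c * (1 - m1) - d * m2), (d * m2), e, b.
have m2_ge0 : 0 <= m2 by have := h 0 0 1; lra.
have m1_le1 : m1 <= 1 by have := h (- 1) 1 0; lra.
split=> //; last by ring.
split; [nra| |nra].
(* The form at this vector is the second moment of 1 - c (1 - x) - d y. As (1 - x) y has mean 0, it
   reduces to the weight of B. *)
have := h (1 - c) c (- d).
suff -> : 1 * (1 - c) ^+ 2 + q1 * c ^+ 2 + q2 * (- d) ^+ 2 +
  2 * (m1 * (1 - c) * c + m2 * (1 - c) * - d + m2 * c * - d) =
  1 - c * (1 - m1) - d * m2 by [].
transitivity (1 + c * (c * (1 - 2 * m1 + q1)) - 2 * c * (1 - m1)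
   + d * (d * q2) - 2 * d * m2); first by ring.
by rewrite cgg dq; ring.
Qed.

Lemma chain_moments2 (R : rcfType) (m1 m2 q1 q2 : R) :
  feasible2 1 m1 m2 q1 q2 m2 -> moments2 1 m1 m2 q1 q2 m2.
Proof.
move=> /chain_weights [wA [wB [wC [e [b [[A0 B0 C0] w1 [e01 b01] [we wee]
  [wb wbb]]]]]]].
have a01 : 0 <= 1 - e <= 1 by lra.
have one01 : 0 <= (1 : R) <= 1 by rewrite lexx ler01.
have zero01 : 0 <= (0 : R) <= 1 by rewrite lexx ler01.
have hA := moments2_atom (moments2_zero (lexx 0)) A0 a01 zero01
  erefl erefl erefl erefl erefl (lexx _).
have hB := moments2_atom hA B0 one01 zero01
  erefl erefl erefl erefl erefl (lexx _).
by apply: (moments2_atom hB C0 one01 b01); lra.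
Qed.

(* z is nondecreasing along the chain, so only its bounds at A and C matter, and
   these amount to E[z (1 - x)] >= 0 and E[(1 - z) y] >= 0. *)
Lemma chain_moments3 (R : rcfType) (m1 m2 m3 q1 q2 p r : R) :
  feasible2 1 m1 m2 q1 q2 m2 -> 0 < m2 -> m1 < 1 -> 0 <= p -> 0 <= r ->
  let v1 := q1 - m1 ^+ 2 in let v2 := q2 - m2 ^+ 2 in let k := m2 - m1 * m2 in
  let c13 := m1 * m3 + p * v1 + r * k in let c23 := m2 * m3 + p * k + r * v2 in
  c13 <= m3 -> c23 <= m2 ->
  moments3 1 m1 m2 m3 q1 q2
    (m3 ^+ 2 + p * (p * v1 + r * k) + r * (p * k + r * v2)) m2 c13 c23.
Proof.
move=> h m2_gt0 m1_lt1 p0 r0 v1 v2 k c13 c23 c13m c23m.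
have [wA [wB [wC [e [b [[A0 B0 C0] w1 [e01 b01] [we wee] [wb wbb]]]]]]] :=
  chain_weights h.
have a01 : 0 <= 1 - e <= 1 by lra.
have one01 : 0 <= (1 : R) <= 1 by rewrite lexx ler01.
have zero01 : 0 <= (0 : R) <= 1 by rewrite lexx ler01.
(* The third coordinate is an affine function of the first two; the slopes p and r give it
   covariance p v1 + r k with x and p k + r v2 with y. *)
pose z x y := m3 + p * (x - m1) + r * (y - m2).
have m1E : m1 = 1 - wA * e by lra.
have q1E : q1 = wA * e ^+ 2 - 1 + 2 * (1 - wA * e) by lra.
have m2E : m2 = wC * b by lra.
have q2E : q2 = wC * b ^+ 2 by lra.
have wBE : wB = 1 - wA - wC by lra.
(* Since 1 - x vanishes at B and C, E[z (1 - x)] = m3 - c13 is 1 - m1 times the value of z at A. For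
   [zC_le1], likewise, y vanishes at A and B. *)
have zA_ge0 : 0 <= z (1 - e) 0.
  have g_gt0 : 0 < 1 - m1 by lra.
  rewrite -(pmulr_rge0 _ g_gt0).
  suff -> : (1 - m1) * z (1 - e) 0 = m3 - c13 by lra.
  by rewrite /c13 /k /v1 /z q1E m1E m2E; ring.
have zC_le1 : z 1 b <= 1.
  rewrite -subr_ge0 -(pmulr_rge0 _ m2_gt0).
  suff -> : m2 * (1 - z 1 b) = m2 - c23 by lra.
  by rewrite /c23 /k /v2 /z q2E m1E m2E; ring.
have zAB : z (1 - e) 0 <= z 1 0 by rewrite /z; nra.
have zBC : z 1 0 <= z 1 b by rewrite /z; nra.
have zA01 : 0 <= z (1 - e) 0 <= 1 by lra.
have zB01 : 0 <= z 1 0 <= 1 by lra.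
have zC01 : 0 <= z 1 b <= 1 by lra.
have hA := moments3_atom (moments3_zero (lexx 0) (lexx 0) (lexx 0)) A0 a01 zero01
  zA01 erefl erefl erefl erefl erefl erefl erefl (lexx _) (lexx _) (lexx _).
have hB := moments3_atom hA B0 one01 zero01
  zB01 erefl erefl erefl erefl erefl erefl erefl (lexx _) (lexx _) (lexx _).
apply: (moments3_atom hB C0 one01 b01 zC01).
all: try (rewrite le_eqVlt; apply/orP; left; apply/eqP).
all: by rewrite /c13 /c23 /k /v1 /v2 /z ?q1E ?q2E ?wBE ?m1E ?m2E; ring.
Qed.

Lemma convex_ge0 (R : realFieldType) (t a b : R) :
  0 <= t <= 1 -> 0 <= a -> 0 <= b -> 0 <= (1 - t) * a + t * b.
Proof.
move=> t01 a_ge0 b_ge0; have : 0 <= 1 - t by lra.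
by move=> u_ge0; rewrite addr_ge0 ?mulr_ge0 //; lra.
Qed.

(* Raise c12 towards perfect correlation: either that is reached, and the
   two-point construction applies, or one of c12 <= m1, c12 <= m2 becomes tight. *)
Lemma feasible2_prob (R : rcfType) (m1 m2 q1 q2 c12 : R) :
  feasible2 1 m1 m2 q1 q2 c12 -> moments2 1 m1 m2 q1 q2 c12.
Proof.
move=> feas; have [m1_01 m2_01 v1_ge0 v2_ge0] := feasible2_bounds feas.
case: (feas) => h q1m q2m c1 c2.
have cT := psd3_cov_sqrt h v1_ge0.
set s1 := Num.sqrt (q1 - m1 ^+ 2) in cT.
set s2 := Num.sqrt (q2 - m2 ^+ 2) in cT.
have s1_ge0 : 0 <= s1 by exact: sqrtr_ge0.
have s2_ge0 : 0 <= s2 by exact: sqrtr_ge0.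
have s1E : q1 = m1 ^+ 2 + s1 ^+ 2 by rewrite sqr_sqrtr //; ring.
have s2E : q2 = m2 ^+ 2 + s2 ^+ 2 by rewrite sqr_sqrtr //; ring.
pose T := m1 * m2 + s1 * s2.
have hT : psd3 1 m1 m2 q1 q2 T.
  move=> x0 x1 x2; rewrite s1E s2E /T.
  suff -> : 1 * x0 ^+ 2 + (m1 ^+ 2 + s1 ^+ 2) * x1 ^+ 2 +
    (m2 ^+ 2 + s2 ^+ 2) * x2 ^+ 2 +
    2 * (m1 * x0 * x1 + m2 * x0 * x2 + (m1 * m2 + s1 * s2) * x1 * x2) =
    (x0 + m1 * x1 + m2 * x2) ^+ 2 + (s1 * x1 + s2 * x2) ^+ 2
    by rewrite addr_ge0 ?sqr_ge0.
  by ring.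
have [|allT|[t [t01 tge [i ti]]]] := @segment_exit R bool
  (fun i => (if i then m1 else m2) - c12) (fun i => (if i then m1 else m2) - T).
- by case; lra.
- have T1 := allT true; have T2 := allT false.
  (* The hypothesis of [common_slope] for i = j is q_i <= m_i; for i != j it says that T respects
     both bounds. *)
  have [||[] []|t t_gt0 ht] := @common_slope R bool
    (fun i => if i then m1 else m2) (fun i => if i then s1 else s2).
  + by case; lra.
  + by case.
  + by rewrite /T in T1 T2; nra.
  + by rewrite /T in T1 T2; lra.
  + by rewrite /T in T1 T2; lra.
  + by rewrite /T in T1 T2; nra.
  have [a1 b1] := ht true; have [a2 b2] := ht false.
  apply: (moments2_le cT); rewrite s1E s2E.
  exact: (two_point2 t_gt0).
have t1 := tge true; have t2 := tge false.
pose C := c12 + t * (T - c12).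
have cC : c12 <= C by rewrite /C -/T in cT *; nra.
have hC : psd3 1 m1 m2 q1 q2 C.
  move=> x0 x1 x2; have := convex_ge0 t01 (h x0 x1 x2) (hT x0 x1 x2).
  by rewrite /C; lra.
apply: (moments2_le cC).
case: i ti => ti.
  have Cm : C = m1 by rewrite /C; lra.
  rewrite Cm in hC *; apply: moments2_swap; apply: chain_moments2.
  by split=> //; [move=> x0 x1 x2; have := hC x0 x2 x1|]; lra.
have Cm : C = m2 by rewrite /C; lra.
by rewrite Cm in hC *; apply: chain_moments2; split=> //; lra.
Qed.

Lemma feasible2_moments (R : rcfType) (m0 m1 m2 q1 q2 c12 : R) :
  feasible2 m0 m1 m2 q1 q2 c12 -> moments2 m0 m1 m2 q1 q2 c12.
Proof.
case=> h q1m q2m c1 c2; have m0_ge0 := psd3_m0 h.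
have q1_ge0 : 0 <= q1 by have := h 0 1 0; lra.
have q2_ge0 : 0 <= q2 by have := h 0 0 1; lra.
(* Without mass, m_i^2 <= m0 q_i makes the means vanish, and then q_i <= m_i the second moments. *)
have [m00|m0_neq0] := eqVneq m0 0.
  have : m1 ^+ 2 <= m0 * q1.
    by apply: discriminant_le => x y; have := h x y 0; lra.
  have : m2 ^+ 2 <= m0 * q2.
    by apply: discriminant_le => x y; have := h x 0 y; lra.
  rewrite m00 !mul0r => m20 m10.
  have m1E : m1 = 0 by apply/eqP; rewrite -sqrf_eq0 eq_le sqr_ge0 m10.
  have m2E : m2 = 0 by apply/eqP; rewrite -sqrf_eq0 eq_le sqr_ge0 m20.
  have -> : q1 = 0 by lra.
  have -> : q2 = 0 by lra.
  by rewrite m1E m2E; apply: moments2_zero; rewrite -m1E.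
have i_ge0 : 0 <= m0^-1 by rewrite invr_ge0.
have -> : m0 = m0 * 1 by ring.
rewrite -[m1](mulVKf m0_neq0) -[m2](mulVKf m0_neq0) -[q1](mulVKf m0_neq0).
rewrite -[q2](mulVKf m0_neq0) -[c12](mulVKf m0_neq0) mulr1.
rewrite -[X in moments2 X]mulr1; apply: moments2_scale => //.
apply: feasible2_prob; split; rewrite ?ler_wpM2l //.
move=> x0 x1 x2; have := mulr_ge0 i_ge0 (h x0 x1 x2).
rewrite 2!mulrDr -[1](mulVf m0_neq0); lra.
Qed.

(** * The moment problem on the three-dimensional cube *)

(* x < 1 forces y = z = 0: split off one atom (1 - e, 0, 0) and solve the planar
   problem on the face x = 1. *)
Lemma feasible3_face1 (R : rcfType) (m1 m2 m3 q1 q2 q3 c23 : R) :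
  feasible3 1 m1 m2 m3 q1 q2 q3 m2 m3 c23 ->
  moments3 1 m1 m2 m3 q1 q2 q3 m2 m3 c23.
Proof.
move=> [h [q1m q2m q3m] _ _ [c2 c3]].
have [c [e [c0 e01 cgg ce cee]]] :
  exists c e, [/\ 0 <= c, 0 <= e <= 1, c * (1 - 2 * m1 + q1) = 1 - m1,
    c * (1 - m1) * e = 1 - m1 & c * (1 - m1) * e ^+ 2 = 1 - 2 * m1 + q1].
  apply: one_atom; have := h (- m1) 1 0 0; have := h (- 1) 1 0 0; lra.
have g_ge0 : 0 <= 1 - m1 by have := h (- 1) 1 0 0; lra.
set w := c * (1 - m1) in ce cee.
have w_ge0 : 0 <= w by exact: mulr_ge0.
have F : feasible2 (1 - w) m2 m3 q2 q3 c23.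
  (* The function 1 - c (1 - x) is 1 on the face x = 1 and, if m1 < 1, vanishes at the atom split
     off. Replacing the constant x0 by x0 (1 - c (1 - x)) therefore gives the form of the remaining
     mass. *)
  split=> // x0 x2 x3; have := h ((1 - c) * x0) (c * x0) x2 x3.
  suff -> : 1 * ((1 - c) * x0) ^+ 2 + q1 * (c * x0) ^+ 2 + q2 * x2 ^+ 2 +
    q3 * x3 ^+ 2 + 2 * (m1 * ((1 - c) * x0) * (c * x0) +
    m2 * ((1 - c) * x0) * x2 + m3 * ((1 - c) * x0) * x3 + m2 * (c * x0) * x2 +
    m3 * (c * x0) * x3 + c23 * x2 * x3) = (1 - w) * x0 ^+ 2 + q2 * x2 ^+ 2 +
    q3 * x3 ^+ 2 + 2 * (m2 * x0 * x2 + m3 * x0 * x3 + c23 * x2 * x3) by [].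
  transitivity ((1 - 2 * w + c * (c * (1 - 2 * m1 + q1))) * x0 ^+ 2 +
    q2 * x2 ^+ 2 + q3 * x3 ^+ 2 +
    2 * (m2 * x0 * x2 + m3 * x0 * x3 + c23 * x2 * x3)); first by rewrite /w; ring.
  by rewrite cgg -/w; ring.
have one01 : 0 <= (1 : R) <= 1 by rewrite lexx ler01.
have zero01 : 0 <= (0 : R) <= 1 by rewrite lexx ler01.
have a01 : 0 <= 1 - e <= 1 by lra.
by apply: (moments3_atom (moments2_extend one01 (feasible2_moments F)) w_ge0 a01
  zero01 zero01); lra.
Qed.

(* Dually, x > 0 forces y = z = 1. *)
Lemma feasible3_face0 (R : rcfType) (m1 m2 m3 q1 q2 q3 c23 : R) :
  feasible3 1 m1 m2 m3 q1 q2 q3 m1 m1 c23 ->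
  moments3 1 m1 m2 m3 q1 q2 q3 m1 m1 c23.
Proof.
move=> [h [q1m q2m q3m] _ _ [c2 c3]].
have [c [e [c0 e01 cgg ce cee]]] :
  exists c e, [/\ 0 <= c, 0 <= e <= 1, c * q1 = m1,
    c * m1 * e = m1 & c * m1 * e ^+ 2 = q1].
  apply: one_atom; have := h (- m1) 1 0 0; have := h 0 1 0 0; lra.
have m1_ge0 : 0 <= m1 by have := h 0 1 0 0; lra.
set w := c * m1 in ce cee.
have w_ge0 : 0 <= w by exact: mulr_ge0.
have F : feasible2 (1 - w) (m2 - w) (m3 - w) (q2 - w) (q3 - w) (c23 - w).
  split; rewrite ?lerD2r // => x0 x2 x3.
  (* Subtracting c (x0 + x2 + x3) x changes nothing on the face x = 0 and, if m1 > 0, cancels x0 +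
     x2 y + x3 z at the atom (e, 1, 1), since then c e = 1. *)
  have := h x0 (- c * (x0 + x2 + x3)) x2 x3.
  suff -> : 1 * x0 ^+ 2 + q1 * (- c * (x0 + x2 + x3)) ^+ 2 + q2 * x2 ^+ 2 +
    q3 * x3 ^+ 2 + 2 * (m1 * x0 * (- c * (x0 + x2 + x3)) + m2 * x0 * x2 +
    m3 * x0 * x3 + m1 * (- c * (x0 + x2 + x3)) * x2 +
    m1 * (- c * (x0 + x2 + x3)) * x3 + c23 * x2 * x3) =
    (1 - w) * x0 ^+ 2 + (q2 - w) * x2 ^+ 2 + (q3 - w) * x3 ^+ 2 +
    2 * ((m2 - w) * x0 * x2 + (m3 - w) * x0 * x3 + (c23 - w) * x2 * x3) by [].
  transitivity ((c * (c * q1) - 2 * w) * (x0 + x2 + x3) ^+ 2 + x0 ^+ 2 +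
    q2 * x2 ^+ 2 + q3 * x3 ^+ 2 +
    2 * (m2 * x0 * x2 + m3 * x0 * x3 + c23 * x2 * x3)); first by rewrite /w; ring.
  by rewrite cgg -/w; ring.
have one01 : 0 <= (1 : R) <= 1 by rewrite lexx ler01.
have zero01 : 0 <= (0 : R) <= 1 by rewrite lexx ler01.
by apply: (moments3_atom (moments2_extend zero01 (feasible2_moments F)) w_ge0 e01
  one01 one01); lra.
Qed.

Lemma psd4_cov (R : rcfType) (m1 m2 m3 q1 q2 q3 c12 c13 c23 : R) :
  psd4 1 m1 m2 m3 q1 q2 q3 c12 c13 c23 ->
  [/\ psd3 1 m1 m2 q1 q2 c12, psd3 1 m1 m3 q1 q3 c13 & psd3 1 m2 m3 q2 q3 c23].
Proof.
move=> h; split=> x y z.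
- by have := h x y z 0; lra.
- by have := h x y 0 z; lra.
- by have := h x 0 y z; lra.
Qed.

Lemma psd3_cov_eq (R : rcfType) (m1 m2 q1 q2 c12 : R) :
  psd3 1 m1 m2 q1 q2 c12 -> q1 = m1 ^+ 2 \/ q2 = m2 ^+ 2 -> c12 = m1 * m2.
Proof.
move=> /psd3_cov h [] hq; move: h; rewrite hq subrr ?mul0r ?mulr0 => h;
  by apply/eqP; rewrite -subr_eq0 -sqrf_eq0 eq_le sqr_ge0 h.
Qed.

(* z > 0 forces y = 1 and y > 0 forces x = 1, hence z > 0 should force x = 1.
   Gluing the marginals on (x, y) and (y, z) conditionally independently given y
   yields a positive semidefinite completion with c13 >= m3; interpolate. *)
Lemma feasible3_chain (R : rcfType) (m1 m2 m3 q1 q2 q3 c13 : R) :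
  feasible3 1 m1 m2 m3 q1 q2 q3 m2 c13 m3 ->
  moments3 1 m1 m2 m3 q1 q2 q3 m2 c13 m3.
Proof.
move=> F; case: (F) => h [q1m q2m q3m] [m21 _] [c13_1 c13_3] [m32 _].
(* With [c13] raised to [m3], both y > 0 and z > 0 force x = 1, the situation of
   [feasible3_face1]. *)
suff h' : psd4 1 m1 m2 m3 q1 q2 q3 m2 m3 m3.
  apply: (@moments3_le _ _ _ _ _ _ _ _ m2 m3 m3) => //.
  by apply: feasible3_face1; split=> //; lra.
have [h12 h13 h23] := psd4_cov h.
have m3_ge0 : 0 <= m3 by have := h 0 0 0 1; lra.
have q2_ge0 : 0 <= q2 by have := h 0 0 1 0; lra.
have v1_ge0 : 0 <= q1 - m1 ^+ 2 by have := h (- m1) 1 0 0; lra.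
have v2_ge0 : 0 <= q2 - m2 ^+ 2 by have := h (- m2) 0 1 0; lra.
have v3_ge0 : 0 <= q3 - m3 ^+ 2 by have := h (- m3) 0 0 1; lra.
have m1_le1 : m1 <= 1 by nra.
have [c13E|c13_neq] := eqVneq c13 m3; 
  first by rewrite -{2}c13E; move: h; rewrite c13E.
have c13_lt : c13 < m3 by rewrite lt_def eq_sym c13_neq.
(* If y were constant, its covariances would vanish; then m1 = 1 or m2 = m3 = 0, and in both cases
   [c13] would equal [m3]. *)
have v2_gt0 : 0 < q2 - m2 ^+ 2.
  rewrite lt_def v2_ge0 andbT; apply/eqP => v20.
  have q2E : q2 = m2 ^+ 2 by lra.
  have e12 := psd3_cov_eq h12 (or_intror q2E).
  have e23 := psd3_cov_eq h23 (or_introl q2E).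
  have [m1E|m1_neq1] := eqVneq m1 1.
    have q1E : q1 = m1 ^+ 2 by rewrite m1E in v1_ge0 q1m *; lra.
    by have := psd3_cov_eq h13 (or_introl q1E); rewrite m1E; lra.
  have m2E : m2 = 0.
    apply/eqP; have : m2 * (1 - m1) == 0.
      by rewrite mulrBr -[m2 * m1]mulrC -e12; lra.
    by rewrite mulf_eq0 subr_eq0 [1 == _]eq_sym (negbTE m1_neq1) orbF.
  have m3E : m3 = 0 by lra.
  have q3E : q3 = m3 ^+ 2 by rewrite m3E in q3m v3_ge0 *; lra.
  by have := psd3_cov_eq h13 (or_intror q3E); rewrite m3E; lra.
have m2_lt1 : m2 < 1 by nra.
(* a + b y is the linear regression of z on y, whose covariance is m3 (1 - m2). *)
pose b := m3 * (1 - m2) / (q2 - m2 ^+ 2).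
have b_ge0 : 0 <= b by rewrite !mulr_ge0 ?invr_ge0 //; lra.
pose a := m3 - b * m2.
have abE : a + b * m2 = m3 by rewrite /a; ring.
have abE2 : a * m2 + b * q2 = m3.
  have -> : a * m2 + b * q2 = m3 * m2 + b * (q2 - m2 ^+ 2) by rewrite /a; ring.
  by rewrite divfK ?gt_eqF //; ring.
clearbody a b.
have a_le0 : a <= 0.
  have : a * (1 - m2) = b * (q2 - m2) by lra.
  by nra.
(* The mixed moment of x with a + b y. It exceeds [m3] by a (m1 - 1), which is nonnegative as a <=
   0. *)
pose r := a * m1 + b * m2.
have r_ge : m3 <= r by rewrite /r; nra.
(* The form is that of (x, y) with z replaced by a + b y, plus the second moment of the residual z -
   a - b y times x3^2. *)
have hr : psd4 1 m1 m2 m3 q1 q2 q3 m2 r m3.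
  move=> x0 x1 x2 x3.
  have k1 := h12 (x0 + a * x3) x1 (x2 + b * x3).
  have k2 : 0 <= q3 - a * m3 - b * m3.
    have := h23 a b (- 1).
    suff -> : 1 * a ^+ 2 + q2 * b ^+ 2 + q3 * (- 1) ^+ 2 +
      2 * (m2 * a * b + m3 * a * - 1 + m3 * b * - 1) = q3 - a * m3 - b * m3 by [].
    transitivity (a * (a + b * m2) + b * (a * m2 + b * q2) + q3 - 2 * a * m3
      - 2 * b * m3); first by ring.
    by rewrite abE abE2; ring.
  have k3 := addr_ge0 k1 (mulr_ge0 k2 (sqr_ge0 x3)).
  suff <- : 1 * (x0 + a * x3) ^+ 2 + q1 * x1 ^+ 2 + q2 * (x2 + b * x3) ^+ 2 +
    2 * (m1 * (x0 + a * x3) * x1 + m2 * (x0 + a * x3) * (x2 + b * x3) +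
    m2 * x1 * (x2 + b * x3)) + (q3 - a * m3 - b * m3) * x3 ^+ 2 =
    1 * x0 ^+ 2 + q1 * x1 ^+ 2 + q2 * x2 ^+ 2 + q3 * x3 ^+ 2 +
    2 * (m1 * x0 * x1 + m2 * x0 * x2 + m3 * x0 * x3 + m2 * x1 * x2 +
    r * x1 * x3 + m3 * x2 * x3) by [].
  transitivity (1 * x0 ^+ 2 + q1 * x1 ^+ 2 + q2 * x2 ^+ 2 +
    (q3 - a * m3 - b * m3 + a * (a + b * m2) + b * (a * m2 + b * q2)) * x3 ^+ 2 +
    2 * (m1 * x0 * x1 + m2 * x0 * x2 + (a + b * m2) * x0 * x3 + m2 * x1 * x2 +
    r * x1 * x3 + (a * m2 + b * q2) * x2 * x3)); first by rewrite /r; ring.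
  by rewrite abE abE2; ring.
have d_gt0 : 0 < r - c13 by lra.
pose t := (m3 - c13) / (r - c13).
have t01 : 0 <= t <= 1.
  by rewrite divr_ge0 ?subr_ge0 ?(ltW d_gt0) //= ?ler_pdivrMr //; lra.
have tE : t * (r - c13) = m3 - c13 by rewrite divfK ?gt_eqF.
move=> x0 x1 x2 x3.
have := convex_ge0 t01 (h x0 x1 x2 x3) (hr x0 x1 x2 x3).
suff -> : forall A B : R, (1 - t) * (1 * x0 ^+ 2 + q1 * x1 ^+ 2 + q2 * x2 ^+ 2 +
   q3 * x3 ^+ 2 + 2 * (m1 * x0 * x1 + m2 * x0 * x2 + m3 * x0 * x3 +
   m2 * x1 * x2 + A * x1 * x3 + m3 * x2 * x3)) + t * (1 * x0 ^+ 2 +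
   q1 * x1 ^+ 2 + q2 * x2 ^+ 2 + q3 * x3 ^+ 2 + 2 * (m1 * x0 * x1 +
   m2 * x0 * x2 + m3 * x0 * x3 + m2 * x1 * x2 + B * x1 * x3 + m3 * x2 * x3)) =
   1 * x0 ^+ 2 + q1 * x1 ^+ 2 + q2 * x2 ^+ 2 + q3 * x3 ^+ 2 +
   2 * (m1 * x0 * x1 + m2 * x0 * x2 + m3 * x0 * x3 + m2 * x1 * x2 +
   (A + t * (B - A)) * x1 * x3 + m3 * x2 * x3).
  by rewrite [c13 + _]addrC tE subrK.
by move=> A B; ring.
Qed.

(** For vectors v_i with Gram matrix (s_i, k_ij), r v2 is given the norm of v3. Cauchy-Schwarz
    yields the bound on [k23]. The last hypothesis, which for independent v1 and v2 says that v1 has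
    no positive coefficient in the projection of v3, transfers it to [k13]. *)
Lemma conic_domination_half (R : rcfType) (s2 s3 k12 k13 k23 : R) :
  0 < s2 -> 0 <= s3 -> k23 ^+ 2 <= s2 * s3 -> 0 < k12 ->
  k13 * s2 <= k12 * k23 ->
  exists r, [/\ 0 <= r, k13 <= r * k12, k23 <= r * s2 & r * (r * s2) = s3].
Proof.
move=> s2_gt0 s3_ge0 h k12_gt0 a_le0.
exists (Num.sqrt (s3 / s2)); set r := Num.sqrt _.
have r_ge0 : 0 <= r by exact: sqrtr_ge0.
have rE : r * (r * s2) = s3.
  by rewrite mulrA -expr2 sqr_sqrtr ?divr_ge0 ?(ltW s2_gt0) // divfK ?gt_eqF.
have rs2 : k23 <= r * s2.
  have rs2_ge0 : 0 <= r * s2 by rewrite mulr_ge0 // ltW.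
  rewrite leNgt; apply/negP => lt; move: h; rewrite leNgt => /negP; apply.
  have -> : s2 * s3 = (r * s2) ^+ 2 by rewrite -rE; ring.
  by nra.
split=> //; rewrite -(ler_pM2r s2_gt0); nra.
Qed.

(* v3 is dominated by a vector of its norm in the conic hull of v1 and v2: rescale
   the projection of v3 to their span if it lies in that hull, and otherwise take a
   multiple of v1 or v2. *)
Lemma conic_domination (R : rcfType) (s1 s2 s3 k12 k13 k23 : R) :
  (forall x y z, 0 <= s1 * x ^+ 2 + s2 * y ^+ 2 + s3 * z ^+ 2
     + 2 * (k12 * x * y + k13 * x * z + k23 * y * z)) -> 0 < k12 ->
  exists p r, [/\ 0 <= p, 0 <= r, k13 <= p * s1 + r * k12, k23 <= p * k12 + r * s2
    & p * (p * s1 + r * k12) + r * (p * k12 + r * s2) = s3].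
Proof.
move=> h k12_gt0.
have s1_ge0 : 0 <= s1 by have := h 1 0 0; lra.
have s2_ge0 : 0 <= s2 by have := h 0 1 0; lra.
have s3_ge0 : 0 <= s3 by have := h 0 0 1; lra.
have k12_le : k12 ^+ 2 <= s1 * s2.
  by apply: discriminant_le => x y; have := h x y 0; lra.
have k13_le : k13 ^+ 2 <= s1 * s3.
  by apply: discriminant_le => x y; have := h x 0 y; lra.
have k23_le : k23 ^+ 2 <= s2 * s3.
  by apply: discriminant_le => x y; have := h 0 x y; lra.
have ss_gt0 : 0 < s1 * s2 by nra.
have s1_gt0 : 0 < s1.
  rewrite lt_def s1_ge0 andbT; apply: contraTneq ss_gt0 => ->.
  by rewrite mul0r ltxx.
have s2_gt0 : 0 < s2.
  rewrite lt_def s2_ge0 andbT; apply: contraTneq ss_gt0 => ->.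
  by rewrite mulr0 ltxx.
have [a_le0|a_gt0] := leP (k13 * s2) (k12 * k23).
  have [r [r_ge0 r1 r2 rE]] :=
    conic_domination_half s2_gt0 s3_ge0 k23_le k12_gt0 a_le0.
  by exists 0, r; split=> //; lra.
have [b_le0|b_gt0] := leP (k23 * s1) (k12 * k13).
  have [r [r_ge0 r1 r2 rE]] :=
    conic_domination_half s1_gt0 s3_ge0 k13_le k12_gt0 b_le0.
  by exists r, 0; split=> //; lra.
(* For parallel v1 and v2 the two strict inequalities contradict each other. *)
have D_gt0 : 0 < s1 * s2 - k12 ^+ 2.
  rewrite lt_def subr_ge0 k12_le andbT subr_eq0; apply/eqP => DE.
  have h1 : k12 * (k12 * k23) < k12 * (k13 * s2) by rewrite ltr_pM2l.
  have h2 : s2 * (k12 * k13) < s2 * (k23 * s1) by rewrite ltr_pM2l.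
  have h3 : k23 * (s1 * s2) = k23 * k12 ^+ 2 by rewrite DE.
  lra.
have D_neq0 : s1 * s2 - k12 ^+ 2 != 0 by rewrite gt_eqF.
pose p := (k13 * s2 - k12 * k23) / (s1 * s2 - k12 ^+ 2).
pose r := (k23 * s1 - k12 * k13) / (s1 * s2 - k12 ^+ 2).
have p_gt0 : 0 < p by rewrite divr_gt0 // subr_gt0.
have r_gt0 : 0 < r by rewrite divr_gt0 // subr_gt0.
have e13 : p * s1 + r * k12 = k13 by rewrite /p /r; field.
have e23 : p * k12 + r * s2 = k23 by rewrite /p /r; field.
clearbody p r.
have k13_gt0 : 0 < k13 by rewrite -e13 addr_gt0 // mulr_gt0.
have k23_gt0 : 0 < k23 by rewrite -e23 addr_gt0 // mulr_gt0.
(* The squared norm of the projection p v1 + r v2 of v3. As q <= s3, the factor that restores the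
   norm of v3 is at least 1, and it can only increase the positive products [k13] and [k23]. *)
pose q := p * k13 + r * k23.
have q_gt0 : 0 < q by rewrite addr_gt0 // mulr_gt0.
have q_le : q <= s3.
  have := h p r (- 1).
  suff -> : s1 * p ^+ 2 + s2 * r ^+ 2 + s3 * (- 1) ^+ 2 +
    2 * (k12 * p * r + k13 * p * - 1 + k23 * r * - 1) = s3 - q by lra.
  transitivity (p * (p * s1 + r * k12) + r * (p * k12 + r * s2) + s3
    - 2 * (p * k13 + r * k23)); first by ring.
  by rewrite e13 e23 /q; ring.
pose k := Num.sqrt (s3 / q).
have k_ge1 : 1 <= k by rewrite -sqrtr1 ler_wsqrtr // ler_pdivlMr // mul1r.
have kE : k * (k * q) = s3.
  by rewrite mulrA -expr2 sqr_sqrtr ?divr_ge0 ?(ltW q_gt0) // divfK ?gt_eqF.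
have k_ge0 : 0 <= k by lra.
clearbody k.
have f13 : k * p * s1 + k * r * k12 = k * k13 by rewrite -e13; ring.
have f23 : k * p * k12 + k * r * s2 = k * k23 by rewrite -e23; ring.
exists (k * p), (k * r); rewrite f13 f23; split.
- by rewrite mulr_ge0 // ltW.
- by rewrite mulr_ge0 // ltW.
- by rewrite ler_peMl // ltW.
- by rewrite ler_peMl // ltW.
- by rewrite -kE /q; ring.
Qed.

Lemma psd4_convex (R : rcfType)
    (t m0 m1 m2 m3 q1 q2 q3 c12 c13 c23 d12 d13 d23 : R) : 0 <= t <= 1 ->
  psd4 m0 m1 m2 m3 q1 q2 q3 c12 c13 c23 ->
  psd4 m0 m1 m2 m3 q1 q2 q3 d12 d13 d23 ->
  psd4 m0 m1 m2 m3 q1 q2 q3 (c12 + t * (d12 - c12)) (c13 + t * (d13 - c13))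
    (c23 + t * (d23 - c23)).
Proof.
move=> t01 h k x0 x1 x2 x3.
by have := convex_ge0 t01 (h x0 x1 x2 x3) (k x0 x1 x2 x3); lra.
Qed.

Lemma feasible3_swap12 (R : rcfType) (m0 m1 m2 m3 q1 q2 q3 c12 c13 c23 : R) :
  feasible3 m0 m1 m2 m3 q1 q2 q3 c12 c13 c23 ->
  feasible3 m0 m2 m1 m3 q2 q1 q3 c12 c23 c13.
Proof.
move=> [h [? ? ?] [? ?] [? ?] [? ?]]; split=> // x0 x1 x2 x3.
by have := h x0 x2 x1 x3; lra.
Qed.

Lemma feasible3_swap23 (R : rcfType) (m0 m1 m2 m3 q1 q2 q3 c12 c13 c23 : R) :
  feasible3 m0 m1 m2 m3 q1 q2 q3 c12 c13 c23 ->
  feasible3 m0 m1 m3 m2 q1 q3 q2 c13 c12 c23.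
Proof.
move=> [h [? ? ?] [? ?] [? ?] [? ?]]; split=> // x0 x1 x2 x3.
by have := h x0 x1 x3 x2; lra.
Qed.

(** [conic_domination], applied to the covariance matrix, replaces the third coordinate by a
    nondecreasing affine function of x and y with the same variance and no smaller covariances. On
    the way there, either the end is reached and [chain_moments3] applies, or a second bound becomes
    tight. *)
Lemma feasible3_tight (R : rcfType) (m1 m2 m3 q1 q2 q3 c13 c23 : R) :
  feasible3 1 m1 m2 m3 q1 q2 q3 m2 c13 c23 ->
  moments3 1 m1 m2 m3 q1 q2 q3 m2 c13 c23.
Proof.
move=> F; case: (F) => h [q1m q2m q3m] [m21 _] [c13_1 c13_3] [c23_2 c23_3].
have [h12 h13 h23] := psd4_cov h.
have q2_ge0 : 0 <= q2 by have := h 0 0 1 0; lra.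
have v1_ge0 : 0 <= q1 - m1 ^+ 2 by have := h (- m1) 1 0 0; lra.
have v2_ge0 : 0 <= q2 - m2 ^+ 2 by have := h (- m2) 0 1 0; lra.
have m1_le1 : m1 <= 1 by nra.
(* In the cases m2 = 0 and m1 = 1 the covariance of x and y is 0; one coordinate is constant, and
   this makes a second bound tight at once. *)
have [m2E|m2_neq0] := eqVneq m2 0.
  have q2E : q2 = m2 ^+ 2 by rewrite m2E in q2m v2_ge0 *; lra.
  have c23E : c23 = m2 by rewrite (psd3_cov_eq h23 (or_introl q2E)) m2E; ring.
  rewrite c23E in F *; apply: moments3_swap12; apply: feasible3_face0.
  exact: feasible3_swap12.
have m2_gt0 : 0 < m2 by rewrite lt_def m2_neq0; lra.
have [m1E|m1_neq1] := eqVneq m1 1.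
  have q1E : q1 = m1 ^+ 2 by rewrite m1E in v1_ge0 q1m *; lra.
  have c13E : c13 = m3 by rewrite (psd3_cov_eq h13 (or_introl q1E)) m1E; ring.
  by rewrite c13E in F *; apply: feasible3_face1.
have m1_lt1 : m1 < 1 by rewrite lt_def eq_sym m1_neq1.
have k_gt0 : 0 < m2 - m1 * m2.
  have -> : m2 - m1 * m2 = (1 - m1) * m2 by ring.
  by rewrite mulr_gt0 // subr_gt0.
have [|p [r [p_ge0 r_ge0 d13 d23 nE]]] := @conic_domination R (q1 - m1 ^+ 2)
  (q2 - m2 ^+ 2) (q3 - m3 ^+ 2) (m2 - m1 * m2) (c13 - m1 * m3) (c23 - m2 * m3)
  _ k_gt0.
  by move=> x y z; have := h (- (m1 * x + m2 * y + m3 * z)) x y z; lra.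
pose t13 := m1 * m3 + p * (q1 - m1 ^+ 2) + r * (m2 - m1 * m2).
pose t23 := m2 * m3 + p * (m2 - m1 * m2) + r * (q2 - m2 ^+ 2).
have t13_ge : c13 <= t13 by rewrite /t13; lra.
have t23_ge : c23 <= t23 by rewrite /t23; lra.
have hT : psd4 1 m1 m2 m3 q1 q2 q3 m2 t13 t23.
  move=> x0 x1 x2 x3.
  (* The form of (x, y) with z replaced by m3 + p (x - m1) + r (y - m2). *)
  have := h12 (x0 + (m3 - p * m1 - r * m2) * x3) (x1 + p * x3) (x2 + r * x3).
  have -> : q3 = m3 ^+ 2 + (p * (p * (q1 - m1 ^+ 2) + r * (m2 - m1 * m2)) +
    r * (p * (m2 - m1 * m2) + r * (q2 - m2 ^+ 2))) by lra.
  by rewrite /t13 /t23; lra.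
have [|allT|[t [t01 tge [i ti]]]] := @segment_exit R (bool * bool)%type
  (fun i => if i.1 then (if i.2 then m1 else m3) - c13
            else (if i.2 then m2 else m3) - c23)
  (fun i => if i.1 then (if i.2 then m1 else m3) - t13
            else (if i.2 then m2 else m3) - t23).
- by move=> [[] []] /=; lra.
- have a13 := allT (true, false); have a23 := allT (false, true).
  rewrite /= !subr_ge0 in a13 a23.
  apply: (moments3_le (lexx m2) t13_ge t23_ge).
  have -> : q3 = m3 ^+ 2 + p * (p * (q1 - m1 ^+ 2) + r * (m2 - m1 * m2)) +
    r * (p * (m2 - m1 * m2) + r * (q2 - m2 ^+ 2)) by lra.
  by apply: chain_moments3.
have hC := psd4_convex t01 h hT.
have b11 := tge (true, true); have b10 := tge (true, false).
have b01 := tge (false, true); have b00 := tge (false, false).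
rewrite /= in b11 b10 b01 b00.
have t_ge0 : 0 <= t by lra.
have e12 : m2 + t * (m2 - m2) = m2 by ring.
rewrite e12 in hC.
have e13 : c13 <= c13 + t * (t13 - c13).
  by rewrite lerDl mulr_ge0 // subr_ge0.
have e23 : c23 <= c23 + t * (t23 - c23).
  by rewrite lerDl mulr_ge0 // subr_ge0.
apply: (moments3_le (lexx m2) e13 e23).
set C13 := c13 + _ in hC *; set C23 := c23 + _ in hC *.
have FC : feasible3 1 m1 m2 m3 q1 q2 q3 m2 C13 C23.
  by rewrite /C13 /C23; split=> //; lra.
(* The new tight bound says, in turn: x > 0 forces z = 1, a chain since y > 0 forces x = 1; z > 0
   forces x = 1, a face; y > 0 forces z = 1 besides x = 1, the dual face; z > 0 forces y = 1, again
   a chain. *)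
case: i ti => [[] []] /= ti.
- have CE : C13 = m1 by rewrite /C13; lra.
  rewrite CE in FC *; apply: moments3_swap23; apply: moments3_swap12.
  by apply: feasible3_chain; apply: feasible3_swap12; apply: feasible3_swap23.
- have CE : C13 = m3 by rewrite /C13; lra.
  by rewrite CE in FC *; apply: feasible3_face1.
- have CE : C23 = m2 by rewrite /C23; lra.
  rewrite CE in FC *; apply: moments3_swap12; apply: feasible3_face0.
  exact: feasible3_swap12.
- have CE : C23 = m3 by rewrite /C23; lra.
  by rewrite CE in FC *; apply: feasible3_chain.
Qed.

(** The three correlations are raised to 1 together. If the end respects all six bounds, a two-point
    vector works; otherwise the first bound met is brought to the form c12 = m2 by permuting
    coordinates. *)
Lemma feasible3_prob (R : rcfType) (m1 m2 m3 q1 q2 q3 c12 c13 c23 : R) :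
  feasible3 1 m1 m2 m3 q1 q2 q3 c12 c13 c23 ->
  moments3 1 m1 m2 m3 q1 q2 q3 c12 c13 c23.
Proof.
move=> [h [q1m q2m q3m] [c12_1 c12_2] [c13_1 c13_3] [c23_2 c23_3]].
have [h12 h13 h23] := psd4_cov h.
have q1_ge0 : 0 <= q1 by have := h 0 1 0 0; lra.
have q2_ge0 : 0 <= q2 by have := h 0 0 1 0; lra.
have q3_ge0 : 0 <= q3 by have := h 0 0 0 1; lra.
have v1_ge0 : 0 <= q1 - m1 ^+ 2 by have := h (- m1) 1 0 0; lra.
have v2_ge0 : 0 <= q2 - m2 ^+ 2 by have := h (- m2) 0 1 0; lra.
have v3_ge0 : 0 <= q3 - m3 ^+ 2 by have := h (- m3) 0 0 1; lra.
have t12_ge := psd3_cov_sqrt h12 v1_ge0.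
have t13_ge := psd3_cov_sqrt h13 v1_ge0.
have t23_ge := psd3_cov_sqrt h23 v2_ge0.
set s1 := Num.sqrt (q1 - m1 ^+ 2) in t12_ge t13_ge.
set s2 := Num.sqrt (q2 - m2 ^+ 2) in t12_ge t23_ge.
set s3 := Num.sqrt (q3 - m3 ^+ 2) in t13_ge t23_ge.
have s1_ge0 : 0 <= s1 by exact: sqrtr_ge0.
have s2_ge0 : 0 <= s2 by exact: sqrtr_ge0.
have s3_ge0 : 0 <= s3 by exact: sqrtr_ge0.
have s1E : q1 = m1 ^+ 2 + s1 ^+ 2 by rewrite sqr_sqrtr //; ring.
have s2E : q2 = m2 ^+ 2 + s2 ^+ 2 by rewrite sqr_sqrtr //; ring.
have s3E : q3 = m3 ^+ 2 + s3 ^+ 2 by rewrite sqr_sqrtr //; ring.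
clearbody s1 s2 s3.
set t12 := m1 * m2 + s1 * s2 in t12_ge.
set t13 := m1 * m3 + s1 * s3 in t13_ge.
set t23 := m2 * m3 + s2 * s3 in t23_ge.
have hT : psd4 1 m1 m2 m3 q1 q2 q3 t12 t13 t23.
  move=> x0 x1 x2 x3; rewrite s1E s2E s3E /t12 /t13 /t23.
  have := sqr_ge0 (x0 + m1 * x1 + m2 * x2 + m3 * x3).
  by have := sqr_ge0 (s1 * x1 + s2 * x2 + s3 * x3); lra.
have [|allT|[t [t01 tge [i ti]]]] := @segment_exit R ('I_3 * bool)%type
  (fun i => if i.1 == 0 then (if i.2 then m1 else m2) - c12
            else if i.1 == 1 then (if i.2 then m1 else m3) - c13
            else (if i.2 then m2 else m3) - c23)
  (fun i => if i.1 == 0 then (if i.2 then m1 else m2) - t12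
            else if i.1 == 1 then (if i.2 then m1 else m3) - t13
            else (if i.2 then m2 else m3) - t23).
- by move=> [j []] /=; case: ifP => _; [|case: ifP => _| |case: ifP => _]; lra.
- have a1 := allT (0, true); have a2 := allT (0, false).
  have a3 := allT (1, true); have a4 := allT (1, false).
  have a5 := allT (2, true); have a6 := allT (2, false).
  rewrite /= in a1 a2 a3 a4 a5 a6.
  apply: (moments3_le t12_ge t13_ge t23_ge).
  have [||j k|t t_gt0 ht] := @common_slope R 'I_3
    (fun i => if i == 0 then m1 else if i == 1 then m2 else m3)
    (fun i => if i == 0 then s1 else if i == 1 then s2 else s3).
  + by move=> j; case: ifP => _; [|case: ifP => _]; lra.
  + by move=> j; case: ifP => _; [|case: ifP => _]; lra.
  + rewrite /t12 /t13 /t23 in a1 a2 a3 a4 a5 a6.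
    by case: ifP => _; [|case: ifP => _]; (case: ifP => _; [|case: ifP => _]); lra.
  have [x1 y1] := ht 0; have [x2 y2] := ht 1; have [x3 y3] := ht 2.
  rewrite s1E s2E s3E; exact: (two_point3 t_gt0).
have hC := psd4_convex t01 h hT.
have b1 := tge (0, true); have b2 := tge (0, false).
have b3 := tge (1, true); have b4 := tge (1, false).
have b5 := tge (2, true); have b6 := tge (2, false).
rewrite /= in b1 b2 b3 b4 b5 b6.
have t_ge0 : 0 <= t by lra.
have e12 : c12 <= c12 + t * (t12 - c12) by rewrite lerDl mulr_ge0 // subr_ge0.
have e13 : c13 <= c13 + t * (t13 - c13) by rewrite lerDl mulr_ge0 // subr_ge0.
have e23 : c23 <= c23 + t * (t23 - c23) by rewrite lerDl mulr_ge0 // subr_ge0.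
apply: (moments3_le e12 e13 e23).
set C12 := c12 + _ in hC *; set C13 := c13 + _ in hC *.
set C23 := c23 + _ in hC *.
have FC : feasible3 1 m1 m2 m3 q1 q2 q3 C12 C13 C23.
  by rewrite /C12 /C13 /C23; split=> //; lra.
case: i ti => [j b] /=; case: ifP => _; [|case: ifP => _]; case: b => ti.
- have CE : C12 = m1 by rewrite /C12; lra.
  rewrite CE in FC *; apply: moments3_swap12; apply: feasible3_tight.
  exact: feasible3_swap12.
- have CE : C12 = m2 by rewrite /C12; lra.
  by rewrite CE in FC *; apply: feasible3_tight.
- have CE : C13 = m1 by rewrite /C13; lra.
  rewrite CE in FC *; apply: moments3_swap23; apply: moments3_swap12.
  by apply: feasible3_tight; apply: feasible3_swap12; apply: feasible3_swap23.
- have CE : C13 = m3 by rewrite /C13; lra.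
  rewrite CE in FC *; apply: moments3_swap23; apply: feasible3_tight.
  exact: feasible3_swap23.
- have CE : C23 = m2 by rewrite /C23; lra.
  rewrite CE in FC *; apply: moments3_swap12; apply: moments3_swap23.
  apply: moments3_swap12; apply: feasible3_tight; apply: feasible3_swap12.
  by apply: feasible3_swap23; apply: feasible3_swap12.
- have CE : C23 = m3 by rewrite /C23; lra.
  rewrite CE in FC *; apply: moments3_swap12; apply: moments3_swap23.
  by apply: feasible3_tight; apply: feasible3_swap23; apply: feasible3_swap12.
Qed.

Lemma feasible3_moments (R : rcfType) (m0 m1 m2 m3 q1 q2 q3 c12 c13 c23 : R) :
  feasible3 m0 m1 m2 m3 q1 q2 q3 c12 c13 c23 ->
  moments3 m0 m1 m2 m3 q1 q2 q3 c12 c13 c23.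
Proof.
move=> [h [q1m q2m q3m] [c12_1 c12_2] [c13_1 c13_3] [c23_2 c23_3]].
have m0_ge0 : 0 <= m0 by have := h 1 0 0 0; lra.
have q1_ge0 : 0 <= q1 by have := h 0 1 0 0; lra.
have q2_ge0 : 0 <= q2 by have := h 0 0 1 0; lra.
have q3_ge0 : 0 <= q3 by have := h 0 0 0 1; lra.
have [m00|m0_neq0] := eqVneq m0 0.
  have n1 : m1 ^+ 2 <= m0 * q1.
    by apply: discriminant_le => x y; have := h x y 0 0; lra.
  have n2 : m2 ^+ 2 <= m0 * q2.
    by apply: discriminant_le => x y; have := h x 0 y 0; lra.
  have n3 : m3 ^+ 2 <= m0 * q3.
    by apply: discriminant_le => x y; have := h x 0 0 y; lra.
  rewrite m00 !mul0r in n1 n2 n3.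
  have m1E : m1 = 0 by apply/eqP; rewrite -sqrf_eq0 eq_le sqr_ge0 n1.
  have m2E : m2 = 0 by apply/eqP; rewrite -sqrf_eq0 eq_le sqr_ge0 n2.
  have m3E : m3 = 0 by apply/eqP; rewrite -sqrf_eq0 eq_le sqr_ge0 n3.
  have -> : q1 = 0 by lra.
  have -> : q2 = 0 by lra.
  have -> : q3 = 0 by lra.
  by rewrite m00 m1E m2E m3E; apply: moments3_zero; lra.
have i_ge0 : 0 <= m0^-1 by rewrite invr_ge0.
rewrite -[m1](mulVKf m0_neq0) -[m2](mulVKf m0_neq0) -[m3](mulVKf m0_neq0).
rewrite -[q1](mulVKf m0_neq0) -[q2](mulVKf m0_neq0) -[q3](mulVKf m0_neq0).
rewrite -[c12](mulVKf m0_neq0) -[c13](mulVKf m0_neq0) -[c23](mulVKf m0_neq0).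
rewrite -[X in moments3 X]mulr1; apply: moments3_scale => //.
apply: feasible3_prob; split; rewrite ?ler_wpM2l // => x0 x1 x2 x3.
have := mulr_ge0 i_ge0 (h x0 x1 x2 x3); rewrite -[1](mulVf m0_neq0); lra.
Qed.

(** * From matrices to moments of atomic measures *)

Lemma symmetricmxP (R : realType) (n : nat) (A : 'M[R]_n) :
  reflect (forall i j, A i j = A j i) (A \is symmetricmx).
Proof.
apply: (iffP idP) => [/is_hermitianmxP AE i j|AE].
  by rewrite [in LHS]AE expr0 scale1r !mxE.
by apply/is_hermitianmxP; rewrite expr0 scale1r; apply/matrixP => i j; rewrite !mxE.
Qed.

Lemma quad_formE (R : realType) (n : nat) (A : 'M[R]_n) (x z : 'cV[R]_n) :
  (x^T *m A *m z) 0 0 = \sum_i \sum_j x i 0 * A i j * z j 0.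
Proof.
rewrite mxE exchange_big /=; apply: eq_bigr => j _.
rewrite mxE mulr_suml; apply: eq_bigr => i _; by rewrite mxE.
Qed.

Lemma border_formE (R : realType) (n : nat) (a t : R) (u : 'rV[R]_n)
    (v : 'cV[R]_n) (A : 'M[R]_n) (x : 'cV[R]_n) :
  ((col_mx t%:M x)^T *m bordermx a u v A *m col_mx t%:M x) 0 0 =
  a * t ^+ 2 + t * ((u *m x) 0 0 + (x^T *m v) 0 0) + (x^T *m A *m x) 0 0.
Proof.
rewrite /bordermx tr_col_mx mul_row_block mul_row_col tr_scalar_mx.
rewrite !mulmxDl -!scalar_mxM mul_mx_scalar mul_scalar_mx -scalemxAl.
by set f := u *m x; set g := x^T *m v; rewrite !mxE eqxx mulr1n; ring.
Qed.

Definition atomic_moments (R : realType) (n : nat) (l0 : R) (l : 'cV[R]_n)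
    (W : 'M[R]_n) (s : seq ({nonneg R} * cube_space R n)) : Prop :=
  [/\ l0 = \sum_(a <- s) a.1%:num,
      forall i, l i 0 = \sum_(a <- s) a.1%:num * cube_val a.2 i 0,
      forall i j, W i j <=
        \sum_(a <- s) a.1%:num * (cube_val a.2 i 0 * cube_val a.2 j 0)
    & forall i, W i i = \sum_(a <- s) a.1%:num * cube_val a.2 i 0 ^+ 2].

Lemma sum_pad3 (R : nmodType) (n : nat) (F : nat -> R) : (n <= 3)%N ->
  (forall k, (n <= k)%N -> F k = 0) -> \sum_(i < n) F i = F 0%N + F 1%N + F 2%N.
Proof.
case: n => [|[|[|[|//]]]] _ F0; rewrite ?big_ord_recr big_ord0 /= ?add0r //.
- by rewrite (F0 0%N) // (F0 1%N) // (F0 2%N) // !addr0.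
- by rewrite (F0 1%N) // (F0 2%N) // !addr0.
- by rewrite (F0 2%N) // !addr0.
Qed.

(** The atoms (x, y, z) are cut down to their first n coordinates. *)
Lemma moments3_atomic (R : realType) (n : nat)
    (m0 m1 m2 m3 q1 q2 q3 c12 c13 c23 : R) (l : 'cV[R]_n) (W : 'M[R]_n) :
  (n <= 3)%N -> moments3 m0 m1 m2 m3 q1 q2 q3 c12 c13 c23 ->
  (forall i, l i 0 = [:: m1; m2; m3]`_i) ->
  (forall i j, W i j = [:: [:: q1; c12; c13]`_j; [:: c12; q2; c23]`_j;
                           [:: c13; c23; q3]`_j]`_i) ->
  exists s, atomic_moments m0 l W s.
Proof.
move=> n3 M; elim: M l W => {m0 m1 m2 m3 q1 q2 q3 c12 c13 c23}
  [c12 c13 c23 h12 h13 h23 l W lE WE|m0 m1 m2 m3 q1 q2 q3 c12 c13 c23 w x y z m0'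
  m1' m2' m3' q1' q2' q3' c12' c13' c23' _ IH w0 x01 y01 z01 m0E m1E m2E m3E q1E
  q2E q3E h12 h13 h23 l W lE WE].
  exists [::]; split; first by rewrite big_nil.
  - case=> [[|[|[|k]]] kn] /=; rewrite big_nil lE //=.
    by have := leq_trans kn n3.
  - case=> [[|[|[|k]]] kn] [[|[|[|k']]] kn'] /=; rewrite big_nil WE //=;
    by [have := leq_trans kn n3 | have := leq_trans kn' n3].
  - case=> [[|[|[|k]]] kn] /=; rewrite big_nil WE //.
    by have := leq_trans kn n3.
have [||s [sm0 sl sW sq]] := IH (\col_i [:: m1'; m2'; m3']`_i)
  (\matrix_(i, j) [:: [:: q1'; c12'; c13']`_j; [:: c12'; q2'; c23']`_j;
                      [:: c13'; c23'; q3']`_j]`_i).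
- by move=> i; rewrite mxE.
- by move=> i j; rewrite mxE.
have cv : (\col_(i < n) [:: x; y; z]`_i) \in cube R n.
  apply/mem_set; case=> [[|[|[|k]]] kn]; rewrite mxE //=.
  by have := leq_trans kn n3.
pose v : cube_space R n := exist (fun u => u \in cube R n) _ cv.
exists ((NngNum w0, v) :: s); split; rewrite ?big_cons /=.
- by rewrite -sm0 m0E addrC.
- move=> i; rewrite big_cons -sl lE !mxE /=.
  by case: i => [[|[|[|k]]] kn] /=; rewrite ?m1E ?m2E ?m3E addrC //;
    have := leq_trans kn n3.
- move=> i j; rewrite big_cons WE /= !mxE; have := sW i j; rewrite mxE.
  case: i j => [[|[|[|k]]] kn] [[|[|[|k']]] kn'] /=;
    by [lra | have := leq_trans kn n3 | have := leq_trans kn' n3].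
- move=> i; rewrite big_cons -sq WE /= !mxE.
  by case: i => [[|[|[|k]]] kn] /=; rewrite ?q1E ?q2E ?q3E addrC //;
    have := leq_trans kn n3.
Qed.

(** Extending l and W by zero to the indices 0, 1, 2 reduces n <= 3 to [feasible3_moments]. *)
Lemma strong_SDP_atomic (R : realType) (n : nat) (l0 : R) (l : 'cV[R]_n)
    (W : 'M[R]_n) : (n <= 3)%N -> W \is symmetricmx ->
  (forall i j, W i j <= l i 0) -> psdmx (bordermx l0 l^T l W) ->
  exists s, atomic_moments l0 l W s.
Proof.
move=> n3 /symmetricmxP sW rlt [_ psd].
pose L (k : nat) : R := if insub k is Some i then l i 0 else 0.
pose V (k k' : nat) : R :=
  if insub k is Some i then (if insub k' is Some j then W i j else 0) else 0.
have LE (i : 'I_n) : l i 0 = L i by rewrite /L valK.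
have VE (i j : 'I_n) : W i j = V i j by rewrite /V !valK.
have L0 k : (n <= k)%N -> L k = 0 by move=> nk; rewrite /L insubN // -leqNgt.
have V0 k k' : (n <= k)%N -> V k k' = 0.
  by move=> nk; rewrite /V insubN // -leqNgt.
have sV k k' : V k k' = V k' k.
  by rewrite /V; case: insub => [i|]; case: insub => [j|] //; rewrite sW.
have form t (v : nat -> R) : 0 <= l0 * t ^+ 2 +
    2 * t * (L 0%N * v 0%N + L 1%N * v 1%N + L 2%N * v 2%N) +
    (v 0%N * V 0%N 0%N * v 0%N + v 0%N * V 0%N 1%N * v 1%N +
       v 0%N * V 0%N 2%N * v 2%N +
     (v 1%N * V 1%N 0%N * v 0%N + v 1%N * V 1%N 1%N * v 1%N +
       v 1%N * V 1%N 2%N * v 2%N) +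
     (v 2%N * V 2%N 0%N * v 0%N + v 2%N * V 2%N 1%N * v 1%N +
       v 2%N * V 2%N 2%N * v 2%N)).
  have := psd (col_mx t%:M (\col_i v i)); rewrite border_formE quad_formE.
  have -> : (l^T *m \col_i v i) 0 0 = L 0%N * v 0%N + L 1%N * v 1%N + L 2%N * v 2%N.
    rewrite mxE -(@sum_pad3 _ n (fun k => L k * v k)) //.
      by apply: eq_bigr => i _; rewrite !mxE LE.
    by move=> k nk; rewrite L0 // mul0r.
  have -> : ((\col_i v i)^T *m l) 0 0 = L 0%N * v 0%N + L 1%N * v 1%N + L 2%N * v 2%N.
    rewrite mxE -(@sum_pad3 _ n (fun k => L k * v k)) //.
      by apply: eq_bigr => i _; rewrite !mxE LE mulrC.
    by move=> k nk; rewrite L0 // mul0r.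
  have -> : \sum_i \sum_j (\col_i v i) i 0 * W i j * (\col_i v i) j 0 =
    \sum_(i < n) (v i * V i 0%N * v 0%N + v i * V i 1%N * v 1%N
                  + v i * V i 2%N * v 2%N).
    apply: eq_bigr => i _.
    rewrite -(@sum_pad3 _ n (fun k => v i * V i k * v k)) //.
      by apply: eq_bigr => j _; rewrite !mxE VE.
    by move=> k nk; rewrite sV V0 // mulr0 mul0r.
  rewrite (@sum_pad3 _ n (fun i => v i * V i 0%N * v 0%N + v i * V i 1%N * v 1%N
                  + v i * V i 2%N * v 2%N)) //; first by lra.
  by move=> k nk; rewrite !V0 // !mulr0 !mul0r !addr0.
have rltV k k' : V k k' <= L k.
  (* For k < n <= k' the claim reads 0 <= L k, which follows from 0 <= V k k <= L k. *)
  have W_ge0 i : 0 <= V i i.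
    have [ni|ni] := leqP n i; first by rewrite V0.
    have := form 0 (fun j => if j == i then 1 else 0).
    case: i ni => [|[|[|i]]] ni /=; try lra.
    by have := leq_trans ni n3.
  have [nk|kn] := leqP n k; first by rewrite V0 // L0.
  have [nk'|kn'] := leqP n k'.
    rewrite sV V0 //; apply: le_trans (W_ge0 k) _.
    by rewrite -[k]/(val (Ordinal kn)) -VE -LE.
  by rewrite -[k]/(val (Ordinal kn)) -[k']/(val (Ordinal kn')) -VE -LE.
apply: (@moments3_atomic _ n l0 (L 0%N) (L 1%N) (L 2%N) (V 0%N 0%N) (V 1%N 1%N)
  (V 2%N 2%N) (V 0%N 1%N) (V 0%N 2%N) (V 1%N 2%N)) => //.
- apply: feasible3_moments; split=> //.
  + move=> x0 x1 x2 x3; have := form x0 (fun k => [:: x1; x2; x3]`_k) => /=.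
    by rewrite (sV 1%N 0%N) (sV 2%N 0%N) (sV 2%N 1%N); lra.
  + by split=> //; rewrite sV.
  + by split=> //; rewrite sV.
  + by split=> //; rewrite sV.
- move=> i; rewrite LE; case: i => [[|[|[|k]]] kn] //=.
  by have := leq_trans kn n3.
- move=> i j; rewrite VE; case: i j => [[|[|[|k]]] kn] [[|[|[|k']]] kn'] //=;
    by [exact: sV | have := leq_trans kn n3 | have := leq_trans kn' n3].
Qed.

(** * Measures on the cube *)

Lemma atomic_measure_exists (d : measure_display) (T : measurableType d)
    (R : realType) (s : seq ({nonneg R} * T)) :
  exists m : {finite_measure set T -> \bar R}, forall f : T -> R,
    measurable_fun setT f -> (forall x, 0 <= f x) ->
    \int[m]_x f x = \sum_(a <- s) a.1%:num * f a.2.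
Proof.
pose a0 : {nonneg R} * T := (NngNum (lexx (0 : R)), point).
pose m_ k : {measure set T -> \bar R} := mscale (nth a0 s k).1 \d_(nth a0 s k).2.
have fin_m : fin_num_fun (msum m_ (size s)).
  by move=> A mA; rewrite /msum; apply/sum_fin_numP => k _ _; rewrite /m_ fin_numM.
pose M := Measure_isFinite.Build _ _ _ (msum m_ (size s)) fin_m.
pose m : {finite_measure set T -> \bar R} := HB.pack (msum m_ (size s)) M.
exists m => f mf f_ge0.
have mfE : measurable_fun setT (EFin \o f) by exact/measurable_EFinP.
rewrite /Rintegral ge0_integral_measure_sum //; last first.
  by move=> x _; rewrite lee_fin.
rewrite (big_nth a0) big_mkord -sum_fine => [|k _].
  apply: eq_bigr => k _.
  rewrite ge0_integral_mscale //= ?integral_dirac //= ?indicT ?mul1r // => x _.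
  by rewrite lee_fin.
rewrite ge0_integral_mscale //= ?integral_dirac //= ?diracT ?mul1e // => x _.
by rewrite lee_fin.
Qed.

Lemma cube_val_continuous (R : realType) (n : nat) (i : 'I_n) :
  continuous (fun x : cube_space R n => cube_val x i 0).
Proof.
move=> x; apply: (@continuous_comp _ _ _ (@cube_val R n) (fun v => v i 0)).
  exact: (@initial_continuous (cube R n) 'cV[R]_n set_val).
exact: coord_continuous.
Qed.

Lemma continuous_measurable_cube (R : realType) (n : nat)
    (f : cube_space R n -> R) :
  continuous f -> measurable_fun setT (f : borel_cube R n -> R).
Proof.
move=> /continuousP cf; apply: (measurability _ (RGenOpens.measurableE R)).
move=> _ [_ [a [b ->] <-]]; rewrite setTI; apply: sub_sigma_algebra.
exact/cf/interval_open.
Qed.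

Lemma Rintegral_sum (d : measure_display) (T : measurableType d) (R : realType)
    (m : {measure set T -> \bar R}) (I : Type) (r : seq I) (f : I -> T -> R) :
  (forall i, m.-integrable setT (EFin \o f i)) ->
  m.-integrable setT (EFin \o (fun x => \sum_(i <- r) f i x)) /\
  \int[m]_x (\sum_(i <- r) f i x) = \sum_(i <- r) \int[m]_x f i x.
Proof.
move=> fi; elim: r => [|i r [IHi IH]].
  under [X in EFin \o X]eq_fun do rewrite big_nil.
  split; first exact: integrable0.
  by under eq_Rintegral do rewrite big_nil; rewrite Rintegral_cst // mul0r big_nil.
have E : (fun x => \sum_(j <- i :: r) f j x) =
         (fun x => f i x + \sum_(j <- r) f j x).
  by apply/funext => x; rewrite big_cons.
split.
  have -> : EFin \o (fun x => \sum_(j <- i :: r) f j x) =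
      ((EFin \o f i) \+ (EFin \o (fun x => (\sum_(j <- r) f j x)%R)))%E.
    by rewrite E.
  exact: integrableD.
by rewrite big_cons -IH -RintegralD // [in LHS]E.
Qed.

Lemma integrable_scale (d : measure_display) (T : measurableType d)
    (R : realType) (m : {measure set T -> \bar R}) (k : R) (f : T -> R) :
  m.-integrable setT (EFin \o f) ->
  m.-integrable setT (EFin \o (fun x => k * f x)).
Proof.
move=> fi; have -> : EFin \o (fun x => k * f x) = (fun x => k%:E * (f x)%:E)%E.
  by apply/funext => x; rewrite /= EFinM.
exact: integrableZl.
Qed.

Lemma cube_val_ge0_le1 (R : realType) (n : nat) (x : cube_space R n) i :
  0 <= cube_val x i 0 <= 1.
Proof. by case: x => x xc; exact: (set_mem xc i). Qed.

Lemma integrable_cube (R : realType) (n : nat)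
    (m : {finite_measure set (borel_cube R n) -> \bar R})
    (f : cube_space R n -> R) (C : R) :
  continuous f -> (forall x, `|f x| <= C) ->
  m.-integrable setT (EFin \o (f : borel_cube R n -> R)).
Proof.
move=> cf fC; apply: measurable_bounded_integrable => //.
- exact/fin_num_fun_lty/fin_num_measure.
- exact: continuous_measurable_cube.
- by exists C; split; [exact: num_real|move=> M CM x _; exact: le_trans (ltW CM)].
Qed.

Lemma integrable_coord (R : realType) (n : nat)
    (m : {finite_measure set (borel_cube R n) -> \bar R}) (i : 'I_n) :
  m.-integrable setT (EFin \o (fun x : borel_cube R n => cube_val x i 0)).
Proof.
apply: (@integrable_cube _ _ _ (fun x => cube_val x i 0) 1).
  exact: cube_val_continuous.
by move=> x; have /andP [x0 x1] := cube_val_ge0_le1 x i; rewrite ger0_norm.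
Qed.

Lemma cube_val_mul_continuous (R : realType) (n : nat) (i j : 'I_n) :
  continuous (fun x : cube_space R n => cube_val x i 0 * cube_val x j 0).
Proof.
by move=> x; exact: (cvgM (@cube_val_continuous R n i x)
  (@cube_val_continuous R n j x)).
Qed.

Lemma integrable_coordM (R : realType) (n : nat)
    (m : {finite_measure set (borel_cube R n) -> \bar R}) (i j : 'I_n) :
  m.-integrable setT
    (EFin \o (fun x : borel_cube R n => cube_val x i 0 * cube_val x j 0)).
Proof.
apply: (@integrable_cube _ _ _ (fun x => cube_val x i 0 * cube_val x j 0) 1).
  exact: cube_val_mul_continuous.
move=> x; have /andP [xi0 xi1] := cube_val_ge0_le1 x i.
have /andP [xj0 xj1] := cube_val_ge0_le1 x j.
by rewrite ger0_norm ?mulr_ge0 // mulr_ile1.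
Qed.

Lemma outer_productE (R : realType) (n : nat) (x : 'cV[R]_n) i j :
  (x *m x^T) i j = x i 0 * x j 0.
Proof. by rewrite mxE big_ord1 mxE. Qed.

(** The second moment matrix serves as W: x_j <= 1 gives W_ij <= l_i, and the bordered form at (t,
    v) is the integral of (t + v^T x)^2. *)
Lemma M0_sub_M_SDP (R : realType) (n : nat) : M0 R n `<=` M_SDP R n.
Proof.
move=> [[l0 l] L] /= [sL [m [l0E lE LW dL]]]; split=> //.
pose W := mx_integral m (fun x => cube_val x *m (cube_val x)^T).
have WE i j : W i j = \int[m]_x (cube_val x i 0 * cube_val x j 0).
  by rewrite mxE; apply: eq_Rintegral => x _; rewrite outer_productE.
have liE i : l i 0 = \int[m]_x cube_val x i 0 by rewrite lE mxE.
have sW i j : W i j = W j i.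
  by rewrite !WE; apply: eq_Rintegral => x _; rewrite mulrC.
exists W; split=> //.
- exact/symmetricmxP.
- move=> i j; have -> : (l *m ones^T) i j = l i 0.
    by rewrite mxE big_ord1 !mxE mulr1.
  rewrite WE liE.
  apply: le_Rintegral => // [||x _]; [exact: integrable_coordM|
    exact: integrable_coord|].
  have /andP [xi0 xi1] := cube_val_ge0_le1 x i.
  have /andP [xj0 xj1] := cube_val_ge0_le1 x j.
  by rewrite ler_piMr.
- rewrite dL; apply/matrixP => i j; rewrite !mxE.
  by apply: eq_Rintegral => x _; rewrite mxE.
split.
  have E : (bordermx l0 l^T l W)^T = bordermx l0 l^T l W.
    rewrite /bordermx tr_block_mx tr_scalar_mx trmxK.
    by congr block_mx; apply/matrixP => i j; rewrite [LHS]mxE sW.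
  by apply/symmetricmxP => i j; rewrite -[in LHS]E mxE.
move=> z; rewrite -(vsubmxK z) [usubmx z]mx11_scalar border_formE quad_formE.
set t := usubmx z 0 0; set v := dsubmx z.
have e1 : (l^T *m v) 0 0 = \sum_i v i 0 * l i 0.
  by rewrite mxE; apply: eq_bigr => i _; rewrite mxE mulrC.
have e2 : (v^T *m l) 0 0 = \sum_i v i 0 * l i 0.
  by rewrite mxE; apply: eq_bigr => i _; rewrite mxE.
have i1 : m.-integrable setT (EFin \o (fun _ : borel_cube R n => 1)).
  apply: (@integrable_cube _ _ _ (fun=> 1) 1) => [|_]; last by rewrite normr1.
  exact: cst_continuous.
have [iS1 eS1] := Rintegral_sum (index_enum 'I_n)
  (fun i => integrable_scale (2 * t * v i 0) (integrable_coord m i)).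
have iS2 i := Rintegral_sum (index_enum 'I_n)
  (fun j => integrable_scale (v i 0 * v j 0) (integrable_coordM m i j)).
have [iS3 eS3] := Rintegral_sum (index_enum 'I_n) (fun i => (iS2 i).1).
have : 0 <= \int[m]_x (t + \sum_i v i 0 * cube_val x i 0) ^+ 2.
  by apply: Rintegral_ge0 => x _; exact: sqr_ge0.
suff -> : \int[m]_x (t + \sum_i v i 0 * cube_val x i 0) ^+ 2 =
   \int[m]_x (t ^+ 2 * 1 + \sum_i 2 * t * v i 0 * cube_val x i 0 +
     \sum_i \sum_j v i 0 * v j 0 * (cube_val x i 0 * cube_val x j 0)).
  rewrite RintegralD //; last first.
    rewrite [X in _.-integrable _ X](_ : _ = (EFin \o (fun x => (t ^+ 2 * 1)%R)) \+
      (EFin \o (fun x => (\sum_i 2 * t * v i 0 * cube_val x i 0)%R)))%E //.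
    by apply: integrableD => //; exact: integrable_scale.
  rewrite RintegralD //; last exact: integrable_scale.
  rewrite RintegralZl // -l0E eS1 eS3 e1 e2.
  suff [-> ->] : \sum_(i < n) \int[m]_x (2 * t * v i 0 * cube_val x i 0) =
    t * (\sum_i v i 0 * l i 0 + \sum_i v i 0 * l i 0) /\
    \sum_(i < n) \int[m]_x (\sum_j v i 0 * v j 0 * (cube_val x i 0 * cube_val x j 0))
    = \sum_i \sum_j v i 0 * W i j * v j 0 by rewrite [t ^+ 2 * _]mulrC.
  split.
    transitivity (\sum_i 2 * t * (v i 0 * l i 0)).
      apply: eq_bigr => i _; rewrite RintegralZl ?liE ?mulrA //.
      exact: integrable_coord.
    by rewrite -mulr_sumr; ring.
  apply: eq_bigr => i _; rewrite (iS2 i).2; apply: eq_bigr => j _.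
  rewrite RintegralZl ?WE //; first by ring.
  exact: integrable_coordM.
apply: eq_Rintegral => x _.
have -> : \sum_i \sum_j v i 0 * v j 0 * (cube_val x i 0 * cube_val x j 0) =
  (\sum_i v i 0 * cube_val x i 0) ^+ 2.
  rewrite expr2 mulr_suml; apply: eq_bigr => i _; rewrite mulr_sumr.
  by apply: eq_bigr => j _; ring.
have -> : \sum_i 2 * t * v i 0 * cube_val x i 0 =
  2 * t * \sum_i v i 0 * cube_val x i 0.
  by rewrite mulr_sumr; apply: eq_bigr => i _; rewrite mulrA.
ring.
Qed.

(** * Separation from closed cones *)

Lemma continuous_sum (R : realType) (T : topologicalType) (I : Type) (r : seq I)
    (f : I -> T -> R) :
  (forall i, continuous (f i)) -> continuous (fun p => \sum_(i <- r) f i p).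
Proof.
move=> cf; elim: r => [|i r IH].
  by under eq_fun do rewrite big_nil; exact: cst_continuous.
under eq_fun do rewrite big_cons.
by move=> p; exact: (cvgD (cf i p) (IH p)).
Qed.

Lemma closed_nonneg (R : realType) (T : topologicalType) (I : Type)
    (g : I -> T -> R) :
  (forall i, continuous (g i)) -> closed [set p | forall i, 0 <= g i p].
Proof.
move=> cg; have -> : [set p | forall i, 0 <= g i p] =
    \bigcap_(i in setT) (g i @^-1` [set x | 0 <= x]).
  by apply/seteqP; split=> p h i; [move=> _; exact: h|exact: (h i Logic.I)].
apply: closed_bigI => i _; apply: preimage_closed; last exact: closed_ge.
by move=> p _; exact: cg.
Qed.

Lemma linear_rV_continuous (R : realType) (k : nat) (L : 'rV[R]_k -> R) :
  (forall a p q, L (a *: p + q) = a * L p + L q) -> continuous L.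
Proof.
move=> linL; have -> : L = fun p => \sum_j p 0 j * L (delta_mx 0 j).
  apply/funext => p; rewrite [in LHS](row_sum_delta p).
  have L0 : L 0 = 0.
    by have := linL (-1) 0 0; rewrite scaler0 addr0 mulN1r addNr.
  elim/big_rec2: _ => [//|j a b _ IH].
  by rewrite linL IH.
apply: continuous_sum => j p.
exact: (cvgM (@coord_continuous R 1 k 0 j p) (cvg_cst _)).
Qed.

(** First-order optimality: a negative slope 2 a would make the expression negative at s = - a / (b
    - a), which is at most 1, because there 2 a + s b = a (1 + s). *)
Lemma slope_ge0 (R : realFieldType) (a b : R) : 0 <= b ->
  (forall s, 0 <= s <= 1 -> 0 <= s * (2 * a) + s ^+ 2 * b) -> 0 <= a.
Proof.
move=> b_ge0 h; rewrite leNgt; apply/negP => a_lt0.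
have d_gt0 : 0 < b - a by lra.
have s_gt0 : 0 < - a / (b - a) by rewrite divr_gt0 //; lra.
have s_le1 : - a / (b - a) <= 1 by rewrite ler_pdivrMr //; lra.
have := h (- a / (b - a)); rewrite (ltW s_gt0) s_le1 => /(_ isT).
have e : (- a / (b - a)) * (b - a) = - a by rewrite divfK ?gt_eqF.
move: (- a / _) s_gt0 s_le1 e => s s_gt0 s_le1 e.
have -> : s * (2 * a) + s ^+ 2 * b = s * (2 * a + s * b) by ring.
by rewrite pmulr_rge0 //; nra.
Qed.

(* The residual N = T p - b of a least-squares solution p over the cone F
   separates b from T F. *)
Lemma cone_least_squares (R : realType) (k : nat) (I : finType)
    (T : I -> 'rV[R]_k -> R) (F : set 'rV[R]_k) (b : I -> R) :
  (forall i a p q, T i (a *: p + q) = a * T i p + T i q) ->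
  closed F -> F 0 -> (forall p q, F p -> F q -> F (p + q)) ->
  (forall a p, 0 <= a -> F p -> F (a *: p)) ->
  (forall C, exists D, forall p, F p -> (forall i, `|T i p| <= C) ->
     forall j, `|p 0 j| <= D) ->
  (exists2 p, F p & forall i, T i p = b i) \/
  exists N : I -> R, [/\ exists2 p, F p & forall i, N i = T i p - b i,
    forall p, F p -> 0 <= \sum_i N i * T i p & \sum_i N i * b i < 0].
Proof.
move=> linT closedF F0 FD FZ bdF.
have contT i : continuous (T i) by exact/linear_rV_continuous/linT.
have T0 i : T i 0 = 0.
  by have := linT i 1 0 0; rewrite scaler0 addr0 mul1r => /eqP;
    rewrite -subr_eq0 opprD addrA subrr sub0r oppr_eq0 => /eqP.
have TZ i a p : T i (a *: p) = a * T i p.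
  by have := linT i a p 0; rewrite !addr0 T0 addr0.
have TD i p q : T i (p + q) = T i p + T i q.
  by have := linT i 1 p q; rewrite scale1r mul1r.
pose f p := \sum_i (T i p - b i) ^+ 2.
have f_ge0 p : 0 <= f p by apply: sumr_ge0 => i _; exact: sqr_ge0.
have contf : continuous f.
  apply: continuous_sum => i p.
  have ci : T i q - b i @[q --> p] --> T i p - b i.
    by exact: (cvgB (contT i p) (cvg_cst _)).
  exact: (cvgM ci ci).
(* On S the values T p are bounded, so the last hypothesis bounds S itself; S is compact, and the
   minimum of f over F is attained there. *)
pose S := F `&` [set p | f p <= f 0].
have closedS : closed S.
  apply: closedI => //.
  apply: (@preimage_closed _ _ f [set x | x <= f 0]); last exact: closed_le.
  by move=> p _; exact: contf.
have [D bdS] := bdF (\sum_i `|b i| + f 0 + 1).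
have compS : compact S.
  have compD : compact [set v : 'rV[R]_k | forall i, v ord0 i \in `[(- D), D]].
    by apply: (@rV_compact _ _ (fun=> `[(- D), D]%classic)) => _; exact: segment_compact.
  apply: subclosed_compact closedS compD _ => p [Fp fp] j.
  rewrite in_itv /= -ler_norml; apply: (bdS p Fp) => i.
  have h1 : (T i p - b i) ^+ 2 <= f 0.
    apply: le_trans fp; rewrite /f (bigD1 i) //= lerDl.
    by apply: sumr_ge0 => j' _; exact: sqr_ge0.
  have h2 : `|T i p - b i| <= f 0 + 1.
    by rewrite -real_normK ?num_real // in h1; have := normr_ge0 (T i p - b i); nra.
  have h3 : `|b i| <= \sum_i `|b i|.
    by rewrite (bigD1 i) //= lerDl; apply: sumr_ge0.
  by have := ler_normD (T i p - b i) (b i); rewrite subrK; lra.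
have [|p pS pmin] := EVT_min_rV _ compS (continuous_subspaceT contf).
  by exists 0; split => /=.
have [Fp fp] := set_mem pS.
have {}pmin q : F q -> f p <= f q.
  move=> Fq; have [fq|/ltW fq] := leP (f q) (f 0).
    by apply: pmin; apply/mem_set; split.
  exact: le_trans fp fq.
pose N i := T i p - b i.
have fE s q : f (p + s *: q) = f p + s * (2 * \sum_i N i * T i q)
    + s ^+ 2 * \sum_i T i q ^+ 2.
  rewrite /f mulr_sumr !mulr_sumr -!big_split; apply: eq_bigr => i _ /=.
  by rewrite TD TZ /N; ring.
have sq_ge0 q : 0 <= \sum_i T i q ^+ 2 by apply: sumr_ge0 => i _; exact: sqr_ge0.
have Nge q : F q -> 0 <= \sum_i N i * T i q.
  move=> Fq; apply: (slope_ge0 (sq_ge0 q)) => s /andP [s0 _].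
  have := pmin (p + s *: q) (FD _ _ Fp (FZ _ _ s0 Fq)).
  by rewrite fE; lra.
(* The direction - p is admissible for s <= 1, since p - s p = (1 - s) p. Together with [Nge] this
   makes N orthogonal to T p. *)
have Np : 0 <= - \sum_i N i * T i p.
  apply: (slope_ge0 (sq_ge0 p)) => s /andP [s0 s1].
  have := pmin (p + (- s) *: p); rewrite fE -{1}[p]scale1r -scalerDl sqrrN.
  by move=> /(_ (FZ _ _ _ Fp)); rewrite subr_ge0 => /(_ s1); lra.
have [N0|N_neq0] := eqVneq (\sum_i N i ^+ 2) 0.
  left; exists p => // i.
  move/eqP: N0; rewrite psumr_eq0 => [/allP /(_ i)|j _]; last exact: sqr_ge0.
  by rewrite mem_index_enum sqrf_eq0 subr_eq0 => /(_ isT) /eqP.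
right; exists N; split=> //; first by exists p.
have N_gt0 : 0 < \sum_i N i ^+ 2.
  by rewrite lt_def N_neq0 sumr_ge0 // => i _; exact: sqr_ge0.
suff : \sum_i N i * b i = \sum_i N i * T i p - \sum_i N i ^+ 2 by lra.
by rewrite -sumrB; apply: eq_bigr => i _; rewrite /N; ring.
Qed.

(** * Certificates built from the products (x0 - x i) x j, and their duals *)

(* The matrix of the quadratic form sum_ij Z i j * (x0 - x i) * x j in (x0, x). *)
Definition rltmx (R : realType) (n : nat) (Z : 'M[R]_n) : 'M[R]_(1 + n) :=
  bordermx 0 (2^-1 *: (ones^T *m Z)) (2^-1 *: (Z^T *m ones))
    (- 2^-1 *: (Z + Z^T)).

Lemma rltmx_linear (R : realType) (n : nat) (a : R) (Z1 Z2 : 'M[R]_n) :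
  rltmx (a *: Z1 + Z2) = a *: rltmx Z1 + rltmx Z2.
Proof.
rewrite /rltmx /bordermx scale_block_mx add_block_mx; congr block_mx.
- by apply/matrixP => i j; rewrite !mxE mul0rn mulr0 addr0.
- by rewrite mulmxDr -scalemxAr scalerDr !scalerA mulrC.
- by rewrite linearP mulmxDl -scalemxAl scalerDr !scalerA mulrC.
- by apply/matrixP => i j; rewrite !mxE; ring.
Qed.

Lemma tr_bordermx (R : realType) (n : nat) (a : R) (u : 'rV[R]_n) (v : 'cV[R]_n)
    (A : 'M[R]_n) : (bordermx a u v A)^T = bordermx a v^T u^T A^T.
Proof. by rewrite /bordermx tr_block_mx tr_scalar_mx. Qed.

Lemma tr_rltmx (R : realType) (n : nat) (Z : 'M[R]_n) : (rltmx Z)^T = rltmx Z.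
Proof.
by rewrite /rltmx tr_bordermx !linearZ /= !trmx_mul !trmxK linearD /= trmxK addrC.
Qed.

(** A certificate thus writes the form of (y0, y, Y) as a positive semidefinite form plus the sum of
    the Z i j (x0 - x i) x j. *)
Lemma border_sub_rlt (R : realType) (n : nat) (y0 : R) (y : 'cV[R]_n)
    (Y Z : 'M[R]_n) :
  bordermx y0 (2^-1 *: (y^T - ones^T *m Z)) (2^-1 *: (y - Z^T *m ones))
    (Y + 2^-1 *: (Z + Z^T)) =
  bordermx y0 (2^-1 *: y^T) (2^-1 *: y) Y - rltmx Z.
Proof.
rewrite /rltmx /bordermx opp_block_mx add_block_mx -!scalerBr.
by congr block_mx; [rewrite raddf0 subr0|rewrite scaleNr opprK].
Qed.

Lemma rlt_formE (R : realType) (n : nat) (Z : 'M[R]_n) (x : 'cV[R]_n) :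
  ((col_mx 1%:M x)^T *m rltmx Z *m col_mx 1%:M x) 0 0 =
  ((ones - x)^T *m Z *m x) 0 0.
Proof.
rewrite border_formE mul0r add0r mul1r.
have sc (B : 'M[R]_1) : B 0 0 = B^T 0 0 by rewrite mxE.
have e2 : (x^T *m (Z^T *m ones)) 0 0 = (ones^T *m Z *m x) 0 0.
  by rewrite [LHS]sc !trmx_mul !trmxK.
have e3 : (x^T *m Z^T *m x) 0 0 = (x^T *m Z *m x) 0 0.
  by rewrite [LHS]sc !trmx_mul !trmxK mulmxA.
rewrite linearB /= !mulmxBl -!scalemxAl -!scalemxAr -scalemxAl mulmxDr mulmxDl.
set c := x^T *m _ in e2 *; set d := ones^T *m Z *m x in e2 *.
set f := x^T *m Z^T *m x in e3 *; set g := x^T *m Z *m x in e3 *.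
by clearbody c d f g; rewrite !mxE e2 e3; lra.
Qed.

Lemma y_formE (R : realType) (n : nat) (y0 : R) (y x : 'cV[R]_n) (Y : 'M[R]_n) :
  ((col_mx 1%:M x)^T *m bordermx y0 (2^-1 *: y^T) (2^-1 *: y) Y *m
    col_mx 1%:M x) 0 0 = y0 + (y^T *m x) 0 0 + (x^T *m Y *m x) 0 0.
Proof.
rewrite border_formE -scalemxAl -scalemxAr.
have -> : (2^-1 *: (x^T *m y)) 0 0 = (2^-1 *: (y^T *m x)) 0 0.
  by rewrite -[x^T *m y]trmxK trmx_mul trmxK !mxE; congr (_ * _);
     apply: eq_bigr => i _; rewrite !mxE.
by set c := y^T *m x; rewrite ![(_ *: c) _ _]mxE; lra.
Qed.

(** On the cube the products (1 - x_i) x_j are nonnegative, hence so are both parts of a certified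
    form. *)
Lemma K_SDP_sub_K0 (R : realType) (n : nat) : K_SDP R n `<=` K0 R n.
Proof.
move=> [[y0 y] Y] /= [sY [Z [Z_ge0 [_ psd]]]]; split=> // x cx.
have := psd (col_mx 1%:M x); rewrite border_sub_rlt mulmxBr mulmxBl.
rewrite [X in 0 <= X]mxE [X in _ + X]mxE rlt_formE y_formE subr_ge0.
apply: le_trans.
rewrite quad_formE; apply: sumr_ge0 => i _; apply: sumr_ge0 => j _.
have /andP [xi0 xi1] := cx i; have /andP [xj0 _] := cx j.
have := Z_ge0 i j; rewrite !mxE => Zij.
by rewrite !mulr_ge0 // subr_ge0.
Qed.

Lemma atomic_M0 (R : realType) (n : nat) (l0 : R) (l : 'cV[R]_n) (L W : 'M[R]_n)
    (s : seq ({nonneg R} * cube_space R n)) :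
  atomic_moments l0 l W s -> L \is symmetricmx -> L <=m W -> diagv L = diagv W ->
  M0 R n (l0, l, L).
Proof.
move=> [sl0 sl sW sd] sL LW dLW; split=> //.
have [m mE] := @atomic_measure_exists _ (borel_cube R n) R s.
have v_ge0 (x : cube_space R n) i : 0 <= cube_val x i 0.
  by have /andP [] := cube_val_ge0_le1 x i.
have m1 : \int[m]_x 1 = \sum_(a <- s) a.1%:num.
  by rewrite mE //; apply: eq_bigr => a _; rewrite mulr1.
have mi i : \int[m]_x cube_val x i 0 = \sum_(a <- s) a.1%:num * cube_val a.2 i 0.
  rewrite mE //; apply: (@continuous_measurable_cube R n (fun x => cube_val x i 0)).
  exact: cube_val_continuous.
have mij i j : \int[m]_x (cube_val x i 0 * cube_val x j 0) =
    \sum_(a <- s) a.1%:num * (cube_val a.2 i 0 * cube_val a.2 j 0).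
  rewrite mE // => [|x]; last exact: mulr_ge0.
  apply: (@continuous_measurable_cube R n
    (fun x => cube_val x i 0 * cube_val x j 0)).
  exact: cube_val_mul_continuous.
exists m; split.
- by rewrite m1.
- by apply/matrixP => i j; rewrite mxE ord1 mi.
- move=> i j; apply: le_trans (LW i j) (le_trans (sW i j) _); rewrite -mij mxE.
  by rewrite le_eqVlt; apply/orP; left; apply/eqP/eq_Rintegral => x _;
    rewrite outer_productE.
- rewrite dLW; apply/matrixP => i j; rewrite !mxE sd.
  under eq_Rintegral do rewrite mxE outer_productE.
  by rewrite mij.
Qed.

Lemma M_SDP_sub_M0 (R : realType) (n : nat) : (n <= 3)%N -> M_SDP R n `<=` M0 R n.
Proof.
move=> n3 [[l0 l] L] /= [sL [W [sW LW Wl dL psd]]].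
have [|s hs] := strong_SDP_atomic n3 sW _ psd; last exact: (atomic_M0 hs).
by move=> i j; have := Wl i j; rewrite [(l *m _) i j]mxE big_ord1 mxE mxE mulr1.
Qed.

Lemma dot_bordermx (R : realType) (n : nat) (a a' : R) (u u' : 'rV[R]_n)
    (v v' : 'cV[R]_n) (A A' : 'M[R]_n) :
  \sum_i \sum_j bordermx a u v A i j * bordermx a' u' v' A' i j =
  a * a' + \sum_i u 0 i * u' 0 i + \sum_i v i 0 * v' i 0 +
  \sum_i \sum_j A i j * A' i j.
Proof.
rewrite big_split_ord big_ord1 big_split_ord big_ord1 /= /bordermx.
rewrite !block_mxEul !mxE eqxx !mulr1n -!addrA; congr (_ + _).
under eq_bigr do rewrite !block_mxEur; congr (_ + _).
under eq_bigr do rewrite big_split_ord big_ord1 /= !block_mxEdl.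
rewrite big_split; congr (_ + _); apply: eq_bigr => i _; apply: eq_bigr => j _.
by rewrite !block_mxEdr.
Qed.

(** The moments (l0, l, W) send (x0 - x i) x j to l j - W i j, so that Z >= 0 is dual to the bounds
    W i j <= l j. *)
Lemma dot_rltmx (R : realType) (n : nat) (l0 : R) (l : 'cV[R]_n)
    (W Z : 'M[R]_n) : W \is symmetricmx ->
  \sum_i \sum_j bordermx l0 l^T l W i j * rltmx Z i j =
  \sum_i \sum_j Z i j * (l j 0 - W i j).
Proof.
move=> /symmetricmxP sW; rewrite dot_bordermx mulr0 add0r.
have e1 : \sum_i l^T 0 i * (2^-1 *: (ones^T *m Z)) 0 i =
    2^-1 * \sum_i \sum_j Z i j * l j 0.
  rewrite exchange_big mulr_sumr; apply: eq_bigr => j _ /=.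
  rewrite !mxE mulrCA mulr_sumr; congr (_ * _); apply: eq_bigr => i _.
  by rewrite !mxE mul1r mulrC.
have e2 : \sum_i l i 0 * (2^-1 *: (Z^T *m ones)) i 0 =
    2^-1 * \sum_i \sum_j Z i j * l j 0.
  rewrite -e1; apply: eq_bigr => i _; rewrite !mxE; congr (_ * (_ * _)).
  by apply: eq_bigr => j _; rewrite !mxE mulrC.
have e3 : \sum_i \sum_j W i j * (- 2^-1 *: (Z + Z^T)) i j =
    - \sum_i \sum_j Z i j * W i j.
  transitivity (- 2^-1 * ((\sum_i \sum_j Z i j * W i j) +
                          (\sum_i \sum_j Z i j * W i j))); last by lra.
  have ex : \sum_i \sum_j Z i j * W i j = \sum_i \sum_j Z j i * W j i.
    exact: exchange_big.
  rewrite {2}ex -big_split mulr_sumr; apply: eq_bigr => i _ /=.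
  rewrite -big_split mulr_sumr; apply: eq_bigr => j _ /=.
  by rewrite !mxE [W j i]sW; ring.
rewrite e1 e2 e3 -mulrDl.
have -> : \sum_i \sum_j Z i j * (l j 0 - W i j) =
    \sum_i \sum_j Z i j * l j 0 - \sum_i \sum_j Z i j * W i j.
  by rewrite -sumrB; apply: eq_bigr => i _; rewrite -sumrB; apply: eq_bigr => j _;
    rewrite mulrBr.
by lra.
Qed.

Lemma psdmx_lin (R : realType) (n : nat) (a : R) (A B : 'M[R]_n) :
  0 <= a -> psdmx A -> psdmx B -> psdmx (a *: A + B).
Proof.
move=> a0 [/symmetricmxP sA hA] [/symmetricmxP sB hB]; split=> [|x].
  by apply/symmetricmxP => i j; rewrite !mxE sA sB.
rewrite mulmxDr mulmxDl -scalemxAr -scalemxAl mxE [X in X + _]mxE.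
by rewrite addr_ge0 ?mulr_ge0.
Qed.

Lemma psdmx0 (R : realType) (n : nat) : psdmx (0 : 'M[R]_n).
Proof.
split=> [|x]; last by rewrite mulmx0 mul0mx mxE.
by apply/symmetricmxP => i j; rewrite !mxE.
Qed.

Lemma psdmx_outer (R : realType) (n : nat) (x : 'cV[R]_n) : psdmx (x *m x^T).
Proof.
split=> [|y]; first by apply/symmetricmxP => i j; rewrite !outer_productE mulrC.
suff -> : (y^T *m (x *m x^T) *m y) 0 0 = (\sum_i y i 0 * x i 0) ^+ 2.
  exact: sqr_ge0.
rewrite quad_formE expr2 mulr_suml; apply: eq_bigr => i _; rewrite mulr_sumr.
by apply: eq_bigr => j _; rewrite outer_productE; ring.
Qed.

(* (l0, l, W) ranges over the dual of the cone of the matrices B such that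
   B - rltmx Z is positive semidefinite for some Z >= 0. *)
Lemma dual_cone_separation (R : realType) (n : nat) (B : 'M[R]_(1 + n)) :
  B \is symmetricmx ->
  (exists2 Z, 0 <=m Z & psdmx (B - rltmx Z)) \/
  exists l0 (l : 'cV[R]_n) W, [/\ W \is symmetricmx, forall i j, W i j <= l j 0,
    psdmx (bordermx l0 l^T l W) &
    \sum_i \sum_j bordermx l0 l^T l W i j * B i j < 0].
Proof.
move=> sB.
(* A row vector p packs a matrix T p with a multiplier Z p. In this lifted space the cone F is
   visibly closed; [bdF] then provides the boundedness that makes the least-squares minimum
   attained. *)
pose k := ((1 + n) * (1 + n) + n * n)%N.
pose T (p : 'rV[R]_k) : 'M[R]_(1 + n) := vec_mx (lsubmx p).
pose Z (p : 'rV[R]_k) : 'M[R]_n := vec_mx (rsubmx p).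
have linT a p q : T (a *: p + q) = a *: T p + T q by rewrite /T !linearP.
have linZ a p q : Z (a *: p + q) = a *: Z p + Z q by rewrite /Z !linearP.
pose F := [set p | 0 <=m Z p /\ psdmx (T p - rltmx (Z p))].
pose Q (x : 'cV[R]_(1 + n)) p := (x^T *m (T p - rltmx (Z p)) *m x) 0 0.
have linQ x a p q : Q x (a *: p + q) = a * Q x p + Q x q.
  rewrite /Q linT linZ rltmx_linear opprD addrACA -scalerBr mulmxDr mulmxDl.
  by rewrite -scalemxAr -scalemxAl mxE [X in X + _]mxE.
have symF p : (T p - rltmx (Z p) \is symmetricmx) <->
    (forall i j, T p i j = T p j i).
  have rs : forall i j, rltmx (Z p) i j = rltmx (Z p) j i.
    by move=> i j; rewrite -[in LHS]tr_rltmx mxE.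
  have subE i j : (T p - rltmx (Z p)) i j = T p i j - rltmx (Z p) i j.
    by rewrite mxE [X in _ + X]mxE.
  split=> [/symmetricmxP h i j|h].
    by have := h i j; rewrite !subE rs => /addIr.
  by apply/symmetricmxP => i j; rewrite !subE rs h.
have closedF : closed F.
  (* One linear inequality for each entry of Z, each ordered pair of indices of T (opposite pairs
     encode symmetry) and each test vector x. *)
  pose g (c : ('I_n * 'I_n) + (('I_(1 + n) * 'I_(1 + n)) + 'cV[R]_(1 + n))) p :=
    match c with
    | inl ij => Z p ij.1 ij.2
    | inr (inl ij) => T p ij.1 ij.2 - T p ij.2 ij.1
    | inr (inr x) => Q x p
    end.
  have -> : F = [set p | forall c, 0 <= g c p].
    apply/seteqP; split=> p.
      move=> [Z0 [/symF sT psd]] [[i j]|[[i j]|x]] /=; last exact: psd.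
        by have := Z0 i j; rewrite mxE.
      by rewrite sT subrr.
    move=> h; split=> [i j|]; first by rewrite mxE; exact: (h (inl (i, j))).
    split=> [|x]; last exact: (h (inr (inr x))).
    apply/symF => i j; apply/eqP; rewrite eq_le.
    have := h (inr (inl (i, j))); have := h (inr (inl (j, i))).
    by rewrite /= !subr_ge0 => -> ->.
  apply: closed_nonneg => -[[i j]|[[i j]|x]]; apply: linear_rV_continuous => a p q /=.
  - by rewrite linZ !mxE.
  - by rewrite linT !mxE; ring.
  - exact: linQ.
have mkF (M : 'M[R]_(1 + n)) Z0 : 0 <=m Z0 -> psdmx (M - rltmx Z0) ->
    exists2 p, F p & T p = M /\ Z p = Z0.
  move=> hZ hM; exists (row_mx (mxvec M) (mxvec Z0)).
    by rewrite /F /= /T /Z row_mxKl row_mxKr !mxvecK.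
  by rewrite /T /Z row_mxKl row_mxKr !mxvecK.
pose I := ('I_(1 + n) * 'I_(1 + n))%type.
have Tnorm C p : (forall i : I, `|T p i.1 i.2| <= C) -> 0 <= C.
  by move=> /(_ (0, 0)); apply: le_trans.
have bdF C : exists D, forall p, F p -> (forall i : I, `|T p i.1 i.2| <= C) ->
    forall j, `|p 0 j| <= D.
  pose S : R := \sum_(i < 1 + n) \sum_(j < 1 + n) C.
  exists (C + 4 * S) => p [Z0 [_ psd]] TC.
  have C_ge0 := Tnorm _ _ TC.
  have S_ge0 : 0 <= S by apply: sumr_ge0 => i _; apply: sumr_ge0.
  move=> j; rewrite -(hsubmxK p); case: (split_ordP j) => j' ->.
    rewrite row_mxEl; case/mxvec_indexP: j' => a b.
    have := TC (a, b); rewrite /= /T mxE => h; apply: le_trans h _; lra.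
  rewrite row_mxEr; case/mxvec_indexP: j' => a b.
  have -> : rsubmx p 0 (mxvec_index a b) = Z p a b by rewrite /Z [RHS]mxE.
  have Zp_ge0 i i' : 0 <= Z p i i' by have := Z0 i i'; rewrite mxE.
  rewrite ger0_norm //.
  (* For x half the unit vector of b, all 1 - x_i are at least 1/2, so Z a b / 4 is at most the form
     of T p at (1, x), which is at most S. *)
  pose x : 'cV[R]_n := \col_i (if i == b then 2^-1 else 0).
  have x01 i : 0 <= x i 0 <= 2^-1 by rewrite mxE; case: ifP => _; lra.
  have xb : x b 0 = 2^-1 by rewrite mxE eqxx.
  have := psd (col_mx 1%:M x); rewrite mulmxBr mulmxBl.
  rewrite [X in 0 <= X]mxE [X in _ + X]mxE rlt_formE subr_ge0 !quad_formE => h.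
  have h1 : 2^-1 * Z p a b * 2^-1 <=
      \sum_i \sum_j (ones - x) i 0 * Z p i j * x j 0.
    have y_ge i : 2^-1 <= (ones - x) i 0.
      by rewrite !mxE; have := x01 i; rewrite mxE; lra.
    have t_ge0 i i' : 0 <= (ones - x) i 0 * Z p i i' * x i' 0.
      have := y_ge i; have /andP [x0 _] := x01 i' => y0.
      by rewrite !mulr_ge0 //; lra.
    rewrite (bigD1 a) //= (bigD1 b) //= xb -addrA.
    apply: ler_wpDr; last by rewrite !ler_wpM2r // invr_ge0.
    by rewrite addr_ge0 // sumr_ge0 // => i _; rewrite ?sumr_ge0.
  have h2 : \sum_i \sum_j col_mx 1%:M x i 0 * T p i j * col_mx 1%:M x j 0 <= S.
    have z1 i : `|(col_mx 1%:M x : 'cV[R]_(1 + n)) i 0| <= 1.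
      case: (split_ordP i) => i' ->; first by rewrite col_mxEu ord1 mxE normr1.
      by rewrite col_mxEd; have /andP [u0 u1] := x01 i'; rewrite ger0_norm //; lra.
    apply: ler_sum => i _; apply: ler_sum => j' _.
    apply: le_trans (ler_norm _) _; rewrite !normrM.
    have a1 := ler_pM (normr_ge0 _) (normr_ge0 _) (z1 i) (TC (i, j')).
    have a2 := ler_pM (mulr_ge0 (normr_ge0 _) (normr_ge0 _)) (normr_ge0 _) a1 (z1 j').
    by rewrite mul1r mulr1 in a2.
  lra.
have rlt0 : rltmx (0 : 'M[R]_n) = 0.
  have := @rltmx_linear R n (-1) 0 0.
  by rewrite scaler0 addr0 scaleN1r addNr.
have [F0 [T0 Z0E]] : F 0 /\ T 0 = 0 /\ Z 0 = 0.
  have T0 : T 0 = 0 by rewrite /T !linear0.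
  have Z0E : Z 0 = 0 by rewrite /Z !linear0.
  rewrite /F /= T0 Z0E rlt0 subr0; split=> //; split; first by move=> i j.
  exact: psdmx0.
have Flin a p q : 0 <= a -> F p -> F q -> F (a *: p + q).
  move=> a0 [Zp hp] [Zq hq]; split.
    move=> i j; rewrite linZ mxE [leRHS]mxE [X in X + _]mxE.
    have := Zp i j; have := Zq i j; rewrite !mxE => *.
    by rewrite addr_ge0 ?mulr_ge0.
  rewrite linT linZ rltmx_linear opprD addrACA -scalerBr.
  exact: (psdmx_lin a0 hp hq).
have FD p q : F p -> F q -> F (p + q).
  by move=> Fp Fq; rewrite -[p]scale1r; exact: Flin.
have FZ a p : 0 <= a -> F p -> F (a *: p).
  by move=> a0 Fp; have := Flin a p 0 a0 Fp F0; rewrite addr0.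
have linTi (i : I) a p q : T (a *: p + q) i.1 i.2 = a * T p i.1 i.2 + T q i.1 i.2.
  by rewrite linT mxE [X in X + _]mxE.
have [[p [Zp hp] TB]|[N [[p [_ [/symF sT _]] NE] Nge Nlt]]] :=
  cone_least_squares (fun i : I => B i.1 i.2) linTi closedF F0 FD FZ bdF.
  left; exists (Z p) => //.
  suff <- : T p = B by [].
  by apply/matrixP => i j; exact: (TB (i, j)).
(* The residual as a matrix; it inherits the symmetry of T p and B, so it is the bordered matrix of
   some (l0, l, W). *)
pose M : 'M[R]_(1 + n) := T p - B.
have ME i j : M i j = N (i, j) by rewrite NE /M mxE [X in _ + X]mxE.
have sM i j : M i j = M j i.
  rewrite /M mxE [X in _ + X]mxE [RHS]mxE [X in _ = _ + X]mxE.
  by rewrite sT (symmetricmxP _ sB i).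
clearbody M.
right; pose l := (ursubmx M)^T; exists (M 0 0), l, (drsubmx M).
have MB : bordermx (M 0 0) l^T l (drsubmx M) = M.
  rewrite -[RHS]submxK /bordermx /l trmxK; congr block_mx.
    apply/matrixP => i j; rewrite !ord1 !mxE eqxx mulr1n.
    by congr (M _ _); apply/val_inj.
  by apply/matrixP => i j; rewrite !mxE sM.
have dotE (A : 'M[R]_(1 + n)) :
    \sum_(i : I) N i * A i.1 i.2 = \sum_i \sum_j M i j * A i j.
  rewrite (pair_bigA _ (fun i j => M i j * A i j)) /=.
  by apply: eq_bigr => -[i j] _; rewrite ME.
have sW : drsubmx M \is symmetricmx.
  by apply/symmetricmxP => i j; rewrite !mxE sM.
split=> //; rewrite ?MB.
(* The bounds come from pairing M with [rltmx] of a matrix unit, the semidefiniteness from pairing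
   it with x x^T and multiplier 0. *)
- move=> i j.
  have [||p0 Fp0 [Tp0 _]] := mkF (rltmx (delta_mx i j)) (delta_mx i j).
  + by move=> a b; rewrite !mxE ler0n.
  + by rewrite subrr; exact: psdmx0.
  have := Nge p0 Fp0.
  suff -> : \sum_i N i * T p0 i.1 i.2 = l j 0 - drsubmx M i j.
    by rewrite subr_ge0.
  rewrite dotE Tp0 -{1}MB dot_rltmx // (bigD1 i) //= (bigD1 j) //= !big1.
  + by rewrite mxE !eqxx mul1r !addr0.
  + by move=> a ai; rewrite big1 // => b _; rewrite mxE (negbTE ai) mul0r.
  + by move=> b bj; rewrite mxE (negbTE bj) andbF mul0r.
- split=> [|x]; first exact/symmetricmxP.
  have [||p0 Fp0 [Tp0 _]] := mkF (x *m x^T) 0.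
  + by move=> a b.
  + by rewrite rlt0 subr0; exact: psdmx_outer.
  have := Nge p0 Fp0; rewrite dotE Tp0 quad_formE.
  suff -> : \sum_i \sum_j M i j * (x *m x^T) i j =
    \sum_i \sum_j x i 0 * M i j * x j 0 by [].
  by apply: eq_bigr => i _; apply: eq_bigr => j _; rewrite outer_productE; ring.
- by rewrite -dotE.
Qed.

Lemma K0_sub_K_SDP (R : realType) (n : nat) : (n <= 3)%N -> K0 R n `<=` K_SDP R n.
Proof.
move=> n3 [[y0 y] Y] /= [q_ge0 sY]; split=> //.
have [symY offY] := sY.
have [||] := @dual_cone_separation R n (bordermx y0 (2^-1 *: y^T) (2^-1 *: y) Y).
- apply/symmetricmxP => i j; rewrite -[in LHS](trmxK (bordermx _ _ _ _)) mxE.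
  rewrite tr_bordermx !linearZ /= trmxK; congr (bordermx _ _ _ _ _ _).
  by apply/matrixP => a b; rewrite mxE (symmetricmxP _ symY).
- by move=> [Z Z0 hZ]; exists Z; rewrite border_sub_rlt.
move=> [l0 [l [W [sW Wl psd]]]]; rewrite dot_bordermx => neg; exfalso.
have [|s [sl0 sl sWs sd]] := strong_SDP_atomic n3 sW _ psd.
  by move=> i j; rewrite (symmetricmxP _ sW).
have : 0 <= \sum_(a <- s) a.1%:num * (y0 + ((y^T *m cube_val a.2) 0 0) +
    ((cube_val a.2)^T *m Y *m cube_val a.2) 0 0).
  apply: sumr_ge0 => a _; apply: mulr_ge0 => //; apply: q_ge0 => i.
  exact: cube_val_ge0_le1.
(* The sum over the atoms is the integral of the form, here compared with the pairing that the
   separation made negative. *)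
suff : \sum_(a <- s) a.1%:num * (y0 + ((y^T *m cube_val a.2) 0 0) +
    ((cube_val a.2)^T *m Y *m cube_val a.2) 0 0) <=
  l0 * y0 + \sum_i l^T 0 i * (2^-1 *: y^T) 0 i + \sum_i l i 0 * (2^-1 *: y) i 0 +
  \sum_i \sum_j W i j * Y i j by lra.
have -> : \sum_i l^T 0 i * (2^-1 *: y^T) 0 i = 2^-1 * \sum_i l i 0 * y i 0.
  by rewrite mulr_sumr; apply: eq_bigr => i _; rewrite !mxE mulrCA.
have -> : \sum_i l i 0 * (2^-1 *: y) i 0 = 2^-1 * \sum_i l i 0 * y i 0.
  by rewrite mulr_sumr; apply: eq_bigr => i _; rewrite !mxE mulrCA.
have e1 : \sum_(a <- s) a.1%:num * (y^T *m cube_val a.2) 0 0 = \sum_i l i 0 * y i 0.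
  under [RHS]eq_bigr do rewrite sl mulr_suml.
  rewrite exchange_big; apply: eq_bigr => a _ /=; rewrite mxE mulr_sumr.
  by apply: eq_bigr => i _; rewrite mxE; ring.
(* Off the diagonal the mixed moments are at least W i j while Y i j <= 0; on the diagonal they are
   exact. *)
have e2 : \sum_(a <- s) a.1%:num *
      ((cube_val a.2)^T *m Y *m cube_val a.2) 0 0 <= \sum_i \sum_j W i j * Y i j.
  have -> : \sum_(a <- s) a.1%:num * ((cube_val a.2)^T *m Y *m cube_val a.2) 0 0 =
      \sum_i \sum_j (\sum_(a <- s) a.1%:num *
         (cube_val a.2 i 0 * cube_val a.2 j 0)) * Y i j.
    under [RHS]eq_bigr do under eq_bigr do rewrite mulr_suml.
    under [RHS]eq_bigr do rewrite exchange_big.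
    rewrite exchange_big; apply: eq_bigr => a _ /=; rewrite quad_formE mulr_sumr.
    apply: eq_bigr => i _; rewrite mulr_sumr; apply: eq_bigr => j _; ring.
  apply: ler_sum => i _; apply: ler_sum => j _.
  have [->|ij] := eqVneq i j; last by rewrite ler_wnM2r // offY.
  by rewrite sd; under eq_bigr do rewrite -expr2.
have -> : \sum_(a <- s) a.1%:num * (y0 + ((y^T *m cube_val a.2) 0 0) +
    ((cube_val a.2)^T *m Y *m cube_val a.2) 0 0) = l0 * y0 +
    \sum_(a <- s) a.1%:num * (y^T *m cube_val a.2) 0 0 + \sum_(a <- s) a.1%:num *
      ((cube_val a.2)^T *m Y *m cube_val a.2) 0 0.
  rewrite sl0 mulr_suml -!big_split; apply: eq_bigr => a _ /=; ring.
by rewrite e1; lra.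
Qed.

Theorem proposition7 (R : realType) (n : nat) (n_ge1 : (1 <= n)%N) :
  [/\ K_SDP R n `<=` K0 R n,
      M0 R n `<=` M_SDP R n &
      (n <= 3)%N -> K_SDP R n = K0 R n /\ M0 R n = M_SDP R n].
Proof.
split; [exact: K_SDP_sub_K0|exact: M0_sub_M_SDP|move=> n3; split].
- by apply/seteqP; split; [exact: K_SDP_sub_K0|exact: K0_sub_K_SDP].
- by apply/seteqP; split; [exact: M0_sub_M_SDP|exact: M_SDP_sub_M0].
Qed.
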